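(* Assume Setting (S) and, in addition, that $|C_n|\le M|d_nD_n|$ for all $n\in\mathbb{N}$. Then for every $\varepsilon\in(0,1)$ and every $T>\frac{2\pi}{\gamma\sqrt{1-\varepsilon}}$ there exist $n_0=n_0(\varepsilon)\in\mathbb{N}$, independent of $T$ and of the coefficients $C_n,D_n,R_n$, and a constant $c(T,\varepsilon)>0$ such that $$\int_0^\infty k(t)\big(|u_1^{n_0}(t)|^2+|u_2^{n_0}(t)|^2\big)dt\ \ge\ c(T,\varepsilon)\sum_{n=n_0}^\infty\big(|C_n|^2+|d_nD_n|^2\big).$$
   Context: Setting (S): $(\omega_n),(\zeta_n),(C_n),(D_n),(c_n),(d_n)$ ($n\ge1$) are complex sequences and $(r_n),(R_n)$ are real sequences. There are constants $\gamma>0$, $\alpha>0$, $\chi<0$, $n'\in\mathbb{N}$, $\mu>0$, $\nu>1/2$, $M>0$, $0<c_1\le c_2$ such that: (H1) $\liminf_{n\to\infty}(\operatorname{Re}\omega_{n+1}-\operatorname{Re}\omega_n)=\liminf_{n\to\infty}(\operatorname{Re}\zeta_{n+1}-\operatorname{Re}\zeta_n)=\gamma$; (H2) $\operatorname{Im}\omega_n\to\alpha$, $r_n\to\chi$, $\operatorname{Im}\zeta_n\to0$; (H3) $\omega_n\ne0$, $\zeta_n\neq0$, $c_1|\zeta_n|\le|d_n|\le c_2|\zeta_n|$ and $|c_n|\le M/|\omega_n|$ for all $n$; (H4) $|R_n|\le\mu n^{-\nu}(|C_n|^2+|d_nD_n|^2)^{1/2}$ for $n\ge n'$ and $|R_n|\le\mu(|C_n|^2+|d_nD_n|^2)^{1/2}$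 for $n\le n'$; (H5) $\sum_n(|C_n|^2+|d_nD_n|^2)<\infty$. For $n_0\in\mathbb{N}$ and $t\in\mathbb{R}$, $u_1^{n_0}(t)=\sum_{n\ge n_0}\big(C_ne^{i\omega_nt}+\overline{C_n}e^{-i\overline{\omega_n}t}+R_ne^{r_nt}+D_ne^{i\zeta_nt}+\overline{D_n}e^{-i\overline{\zeta_n}t}\big)$, $u_2^{n_0}(t)=\sum_{n\ge n_0}\big(d_nD_ne^{i\zeta_nt}+\overline{d_nD_n}e^{-i\overline{\zeta_n}t}+c_nC_ne^{i\omega_nt}+\overline{c_nC_n}e^{-i\overline{\omega_n}t}\big)$. For $T>0$, $k(t):=\sin(\pi t/T)$ for $t\in[0,T]$ and $k(t):=0$ otherwise. *)

(* Defs.v *)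
From Stdlib Require Import Reals Lra.
Open Scope R_scope.

Definition Cpx : Type := (R * R)%type.
Definition Re (z : Cpx) : R := fst z.
Definition Im (z : Cpx) : R := snd z.
Definition Cof (x : R) : Cpx := (x, 0).
Definition C0 : Cpx := (0, 0).
Definition Ci : Cpx := (0, 1).
Definition Cadd (z w : Cpx) : Cpx := (Re z + Re w, Im z + Im w).
Definition Cmul (z w : Cpx) : Cpx :=
  (Re z * Re w - Im z * Im w, Re z * Im w + Im z * Re w).
Definition Copp (z : Cpx) : Cpx := (- Re z, - Im z).
Definition Cconj (z : Cpx) : Cpx := (Re z, - Im z).
Definition Cnorm2 (z : Cpx) : R := Re z * Re z + Im z * Im z.
Definition Cabs (z : Cpx) : R := sqrt (Cnorm2 z).
Definition Cexp (z : Cpx) : Cpx := (exp (Re z) * cos (Im z), exp (Re z) * sin (Im z)).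

Definition liminf_eq (u : nat -> R) (l : R) : Prop :=
  forall eps, eps > 0 ->
    (exists N, forall n, (n >= N)%nat -> u n > l - eps) /\
    (forall N, exists n, (n >= N)%nat /\ u n < l + eps).

Fixpoint Csum (f : nat -> Cpx) (n0 K : nat) : Cpx :=
  match K with
  | O => C0
  | S K' => Cadd (Csum f n0 K') (f (n0 + K')%nat)
  end.

Definition kw (T t : R) : R :=
  match Rle_dec 0 t, Rle_dec t T with
  | left _, left _ => sin (PI * t / T)
  | _, _ => 0
  end.

Definition u1_term (om ze Cc Dc : nat -> Cpx) (Rc r : nat -> R) (n : nat) (t : R) : Cpx :=
  Cadd (Cadd (Cadd (Cadd
    (Cmul (Cc n) (Cexp (Cmul (Cmul Ci (om n)) (Cof t))))
    (Cmul (Cconj (Cc n)) (Cexp (Cmul (Copp (Cmul Ci (Cconj (om n)))) (Cof t)))))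
    (Cof (Rc n * exp (r n * t))))
    (Cmul (Dc n) (Cexp (Cmul (Cmul Ci (ze n)) (Cof t)))))
    (Cmul (Cconj (Dc n)) (Cexp (Cmul (Copp (Cmul Ci (Cconj (ze n)))) (Cof t)))).

Definition u2_term (om ze Cc Dc cc dc : nat -> Cpx) (n : nat) (t : R) : Cpx :=
  Cadd (Cadd (Cadd
    (Cmul (Cmul (dc n) (Dc n)) (Cexp (Cmul (Cmul Ci (ze n)) (Cof t))))
    (Cmul (Cconj (Cmul (dc n) (Dc n))) (Cexp (Cmul (Copp (Cmul Ci (Cconj (ze n)))) (Cof t)))))
    (Cmul (Cmul (cc n) (Cc n)) (Cexp (Cmul (Cmul Ci (om n)) (Cof t)))))
    (Cmul (Cconj (Cmul (cc n) (Cc n))) (Cexp (Cmul (Copp (Cmul Ci (Cconj (om n)))) (Cof t)))).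

Definition energy (T : R) (om ze Cc Dc cc dc : nat -> Cpx) (Rc r : nat -> R)
    (n0 K : nat) (t : R) : R :=
  kw T t * (Cnorm2 (Csum (fun n => u1_term om ze Cc Dc Rc r n t) n0 K)
            + Cnorm2 (Csum (fun n => u2_term om ze Cc Dc cc dc n t) n0 K)).

Definition RInt_eq (f : R -> R) (a b I : R) : Prop :=
  exists pr : Riemann_integrable f a b, RiemannInt pr = I.

Definition wgt (Cc Dc dc : nat -> Cpx) (n : nat) : R :=
  Cnorm2 (Cc n) + Cnorm2 (Cmul (dc n) (Dc n)).

(* Main.v *)
(* Since [sin (PI t / T) >= (T1 / T) sin (PI t / T1)] on [[0, T1]] for [T1 <= T], it suffices to
   bound the energy from below at the single horizon [T1 = 2 PI / (gamma sqrt (1 - eps))], which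
   exceeds the critical [2 PI / gamma]; this is why [n0] depends on [eps] only.  There [u2] alone
   controls everything: Ingham's method bounds its [D]-part from below (tail gaps are close to
   [gamma] and [Im ze_n] is small), its [C]-part is negligible because [c_n = O(1 / om_n)], and
   [|C_n| <= M |d_n D_n|] recovers the coefficients [C_n].  The same computation gives the direct
   inequality, which makes the integrals over the partial sums converge. *)

From Coquelicot Require Import Coquelicot.
Require Import Defs.
From Stdlib Require Import Reals Lra Lia Psatz.
Open Scope R_scope.

(** * Finite sums *)

(** Each exponential plus its conjugate is twice a real part, so the frequencies act as the
    symmetric family of all [x i] and [- x i]: a product of two modes carries both the sum and the
    difference of their frequencies, and [ingham_kernel] governs the cross terms of a square. Its
    rows telescope to at most 1, which is sharp enough to reach the critical horizon: without
    damping, the diagonal beats the cross terms in this estimate exactly when [2 * (PI / T) < g].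
    The obstacle is the damping. As [Im om_n] tends to [alpha > 0], that comparison can fail for the
    [om]-modes, so these are only ever bounded from above, with a constant that may be large;
    smallness comes from [1 / X], where [X] bounds [Re om_n] from below on the tail. For the
    [ze]-modes the comparison survives a small damping [d] by continuity. Both [d] and [X] are fixed
    at [T1]; at the given [T] only the existence of some upper constants matters, and it serves the
    convergence of the integrals. *)

Fixpoint psum (f : nat -> R) (K : nat) : R :=
  match K with O => 0 | S K' => psum f K' + f K' end.

Lemma psum_ext f g K : (forall i, (i < K)%nat -> f i = g i) -> psum f K = psum g K.
Proof.
  induction K as [|K IH]; intros H; simpl; [reflexivity|].
  rewrite IH, H; auto.
Qed.

Lemma psum_le f g K : (forall i, (i < K)%nat -> f i <= g i) -> psum f K <= psum g K.
Proof.
  induction K as [|K IH]; intros H; simpl; [lra|].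
  apply Rplus_le_compat; auto.
Qed.

Lemma psum_plus f g K : psum (fun i => f i + g i) K = psum f K + psum g K.
Proof. induction K as [|K IH]; simpl; [|rewrite IH]; ring. Qed.

Lemma psum_scal c f K : psum (fun i => c * f i) K = c * psum f K.
Proof. induction K as [|K IH]; simpl; [|rewrite IH]; ring. Qed.

Lemma psum_zero K : psum (fun _ => 0) K = 0.
Proof. induction K as [|K IH]; simpl; [|rewrite IH]; ring. Qed.

Lemma psum_ge_0 f K : (forall i, (i < K)%nat -> 0 <= f i) -> 0 <= psum f K.
Proof. intros H. rewrite <- (psum_zero K). now apply psum_le. Qed.

Lemma psum_Rabs f K : Rabs (psum f K) <= psum (fun i => Rabs (f i)) K.
Proof.
  induction K as [|K IH]; simpl; [rewrite Rabs_R0; lra|].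
  eapply Rle_trans; [apply Rabs_triang|lra].
Qed.

Lemma psum_swap (f : nat -> nat -> R) K L :
  psum (fun i => psum (f i) L) K = psum (fun j => psum (fun i => f i j) K) L.
Proof.
  induction K as [|K IH]; simpl; [now rewrite psum_zero|].
  now rewrite psum_plus, IH.
Qed.

Lemma psum_add f K L : psum f (K + L) = psum f K + psum (fun i => f (K + i)%nat) L.
Proof.
  induction L as [|L IH]; simpl; [rewrite Nat.add_0_r; ring|].
  rewrite Nat.add_succ_r; simpl. rewrite IH. ring.
Qed.

Lemma psum_kronecker f n K :
  psum (fun m => if Nat.eqb n m then f m else 0) K = if Nat.ltb n K then f n else 0.
Proof.
  induction K as [|K IH]; simpl; [reflexivity|].
  rewrite IH.
  destruct (Nat.eqb_spec n K); destruct (Nat.ltb_spec n K); destruct (Nat.ltb_spec n (S K));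
    try lia; subst; ring.
Qed.

Lemma psum_square f K :
  (psum f K) ^ 2 = psum (fun i => psum (fun j => f i * f j) K) K.
Proof.
  rewrite (psum_ext (fun i => psum (fun j => f i * f j) K) (fun i => psum f K * f i)).
  - rewrite psum_scal. ring.
  - intros i _. rewrite psum_scal. ring.
Qed.

Lemma psum_cauchy_schwarz f g K :
  (psum (fun i => f i * g i) K) ^ 2
  <= psum (fun i => f i ^ 2) K * psum (fun i => g i ^ 2) K.
Proof.
  induction K as [|K IH]; cbn [psum]; [simpl; lra|].
  assert (Hf : 0 <= psum (fun i => f i ^ 2) K) by (apply psum_ge_0; intros; apply pow2_ge_0).
  assert (Hg : 0 <= psum (fun i => g i ^ 2) K) by (apply psum_ge_0; intros; apply pow2_ge_0).
  set (s := psum (fun i => f i * g i) K) in *.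
  set (A := psum (fun i => f i ^ 2) K) in *.
  set (B := psum (fun i => g i ^ 2) K) in *.
  (* Compare squares: the induction hypothesis bounds [s ^ 2] by [A * B], and the rest is the
     inequality between the arithmetic and geometric means. *)
  assert (H : 2 * s * (f K * g K) <= A * g K ^ 2 + B * f K ^ 2).
  { apply Rsqr_incr_0_var.
    - unfold Rsqr.
      assert (s ^ 2 * (f K * g K) ^ 2 <= A * B * (f K * g K) ^ 2)
        by (apply Rmult_le_compat_r; [apply pow2_ge_0|lra]).
      pose proof (pow2_ge_0 (A * g K ^ 2 - B * f K ^ 2)). nra.
    - apply Rplus_le_le_0_compat; apply Rmult_le_pos; try apply pow2_ge_0; lra. }
  replace ((s + f K * g K) ^ 2) with (s ^ 2 + 2 * s * (f K * g K) + f K ^ 2 * g K ^ 2) by ring.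
  replace ((A + f K ^ 2) * (B + g K ^ 2))
    with (A * B + (A * g K ^ 2 + B * f K ^ 2) + f K ^ 2 * g K ^ 2) by ring.
  lra.
Qed.

(** Schur test: [2 * e i * e j <= e i ^ 2 + e j ^ 2] splits the form into a row part and a column
    part, and symmetry makes the two equal. *)
Lemma psum_schur (q : nat -> nat -> R) (e : nat -> R) S0 K :
  (forall i j, 0 <= q i j) -> (forall i j, q i j = q j i) ->
  (forall i, (i < K)%nat -> psum (q i) K <= S0) ->
  psum (fun i => psum (fun j => e i * e j * q i j) K) K <= S0 * psum (fun i => e i ^ 2) K.
Proof.
  intros Hq Hs HS.
  assert (Hrow : psum (fun i => psum (fun j => e i ^ 2 * q i j) K) K
                 <= S0 * psum (fun i => e i ^ 2) K).
  { rewrite <- psum_scal. apply psum_le. intros i Hi. rewrite psum_scal.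
    rewrite Rmult_comm. apply Rmult_le_compat_r; [apply pow2_ge_0|auto]. }
  assert (Hcol : psum (fun i => psum (fun j => e j ^ 2 * q i j) K) K
                 = psum (fun i => psum (fun j => e i ^ 2 * q i j) K) K).
  { rewrite psum_swap. apply psum_ext; intros i _. apply psum_ext; intros j _.
    now rewrite Hs. }
  apply Rle_trans with (psum (fun i => psum (fun j =>
    (1 / 2) * (e i ^ 2 * q i j) + (1 / 2) * (e j ^ 2 * q i j)) K) K).
  - apply psum_le; intros i _. apply psum_le; intros j _.
    pose proof (Hq i j). pose proof (pow2_ge_0 (e i - e j)). nra.
  - rewrite (psum_ext _ (fun i => (1 / 2) * psum (fun j => e i ^ 2 * q i j) K
                                + (1 / 2) * psum (fun j => e j ^ 2 * q i j) K)).
    + rewrite psum_plus, !psum_scal, Hcol. lra.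
    + intros i _. now rewrite psum_plus, !psum_scal.
Qed.

(* At [n = m] the first fraction is [1 / (0 - 1) = -1], which the last summand cancels;
   with this convention every row telescopes. *)
Definition ingham_kernel (n m : nat) : R :=
  / (4 * (INR n - INR m) ^ 2 - 1) + / (4 * (INR n + INR m + 1) ^ 2 - 1)
  + (if Nat.eqb n m then 1 else 0).

Lemma ingham_kernel_sym n m : ingham_kernel n m = ingham_kernel m n.
Proof.
  unfold ingham_kernel. rewrite Nat.eqb_sym.
  replace ((INR n - INR m) ^ 2) with ((INR m - INR n) ^ 2) by ring.
  now replace (INR n + INR m) with (INR m + INR n) by ring.
Qed.

Lemma INR_diff_sq n m : n <> m -> 1 <= (INR n - INR m) ^ 2.
Proof.
  intros H. destruct (Nat.lt_total n m) as [h|[h|h]]; [|easy|];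
  apply le_INR in h; rewrite S_INR in h; nra.
Qed.

Lemma ingham_kernel_ge_0 n m : 0 <= ingham_kernel n m.
Proof.
  unfold ingham_kernel.
  assert (0 < / (4 * (INR n + INR m + 1) ^ 2 - 1)).
  { apply Rinv_0_lt_compat. pose proof (pos_INR n). pose proof (pos_INR m). nra. }
  destruct (Nat.eqb_spec n m) as [->|Hne].
  - replace (4 * (INR m - INR m) ^ 2 - 1) with (-1) by ring.
    replace (/ -1) with (-1) by field. lra.
  - assert (0 < / (4 * (INR n - INR m) ^ 2 - 1)).
    { apply Rinv_0_lt_compat. pose proof (INR_diff_sq n m Hne). lra. }
    lra.
Qed.

(** These odd integers are the denominators left by the telescoping of the difference terms. *)
Lemma odd_neq_0 n m : 2 * (INR n - INR m) + 1 <> 0.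
Proof.
  rewrite !INR_IZR_INZ, <- minus_IZR, <- (mult_IZR 2), <- plus_IZR.
  apply not_0_IZR. lia.
Qed.

(** Partial fractions, [1 / (4 u^2 - 1) = (1 / (2 u - 1) - 1 / (2 u + 1)) / 2], telescope both
    families. Their boundary terms [1 / (2 n + 1)] at [m = 0] cancel, and those at [K] are both
    negative, which leaves the diagonal correction 1 as the bound. *)
Lemma ingham_kernel_row n K : (n < K)%nat -> psum (ingham_kernel n) K <= 1.
Proof.
  intros HnK. unfold ingham_kernel. rewrite !psum_plus.
  rewrite (psum_kronecker (fun _ => 1)).
  destruct (Nat.ltb_spec n K) as [_|]; [|lia].
  assert (H1 : forall L, psum (fun m => / (4 * (INR n - INR m) ^ 2 - 1)) L
               = / 2 * (/ (2 * (INR n - INR L) + 1) - / (2 * INR n + 1))).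
  { induction L as [|L IH]; cbn [psum].
    - simpl INR. replace (2 * (INR n - 0) + 1) with (2 * INR n + 1) by ring. ring.
    - rewrite IH. pose proof (odd_neq_0 n L) as Ha. pose proof (odd_neq_0 n (S L)) as Hb.
      rewrite S_INR in *. pose proof (pos_INR n).
      replace (4 * (INR n - INR L) ^ 2 - 1)
        with ((2 * (INR n - INR L) + 1) * (2 * (INR n - (INR L + 1)) + 1)) by ring.
      field. repeat split; auto; try lra. }
  assert (H2 : forall L, psum (fun m => / (4 * (INR n + INR m + 1) ^ 2 - 1)) L
               = / 2 * (/ (2 * INR n + 1) - / (2 * (INR n + INR L) + 1))).
  { induction L as [|L IH]; cbn [psum].
    - simpl INR. replace (2 * (INR n + 0) + 1) with (2 * INR n + 1) by ring. ring.
    - rewrite IH, S_INR. pose proof (pos_INR n). pose proof (pos_INR L).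
      replace (4 * (INR n + INR L + 1) ^ 2 - 1)
        with ((2 * (INR n + INR L) + 1) * (2 * (INR n + (INR L + 1)) + 1)) by ring.
      field. repeat split; lra. }
  rewrite H1, H2.
  assert (/ (2 * (INR n - INR K) + 1) < 0).
  { apply Rinv_lt_0_compat. apply le_INR in HnK. rewrite S_INR in HnK. lra. }
  assert (0 < / (2 * (INR n + INR K) + 1)).
  { apply Rinv_0_lt_compat. pose proof (pos_INR n). pose proof (pos_INR K). lra. }
  lra.
Qed.

(** * Integrals against the sine weight *)

Definition wint (T : R) (f : R -> R) : R := RInt (fun t => sin (PI * t / T) * f t) 0 T.

Lemma continuity_ex_RInt f a b : continuity f -> ex_RInt f a b.
Proof.
  intros H. apply (ex_RInt_continuous (V := R_CompleteNormedModule)).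
  intros z _. apply continuity_pt_filterlim, H.
Qed.

Lemma derivable_continuity f : (forall t, ex_derive f t) -> continuity f.
Proof.
  intros H t. apply continuity_pt_filterlim.
  exact (ex_derive_continuous (V := R_NormedModule) f t (H t)).
Qed.

Lemma sine_weight_continuity T : continuity (fun t => sin (PI * t / T)).
Proof. apply derivable_continuity; intros t; auto_derive; auto. Qed.

Lemma wint_ex T f : continuity f -> ex_RInt (fun t => sin (PI * t / T) * f t) 0 T.
Proof.
  intros H. apply continuity_ex_RInt.
  apply (continuity_mult _ f); [apply sine_weight_continuity|exact H].
Qed.

Lemma continuity_psum (f : nat -> R -> R) K :
  (forall i, continuity (f i)) -> continuity (fun t => psum (fun i => f i t) K).
Proof.
  intros H; induction K as [|K IH]; simpl.
  - apply continuity_const; now intros x y.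
  - apply (continuity_plus _ (f K)); auto.
Qed.

Lemma continuity_sq f : continuity f -> continuity (fun t => f t ^ 2).
Proof.
  intros H t. apply (continuity_pt_ext (fun t => f t * f t)).
  - intros; ring.
  - now apply (continuity_mult f f).
Qed.

Lemma wint_ext T f g : (forall t, f t = g t) -> wint T f = wint T g.
Proof. intros H. apply RInt_ext. intros t _. now rewrite H. Qed.

Lemma wint_plus T f g : continuity f -> continuity g ->
  wint T (fun t => f t + g t) = wint T f + wint T g.
Proof.
  intros Hf Hg. unfold wint.
  rewrite <- (RInt_plus (V := R_CompleteNormedModule)); try now apply wint_ex.
  apply RInt_ext. intros t _. unfold plus; simpl. ring.
Qed.

Lemma wint_scal T c f : continuity f -> wint T (fun t => c * f t) = c * wint T f.
Proof.
  intros Hf. unfold wint.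
  rewrite <- (RInt_scal (V := R_CompleteNormedModule)); try now apply wint_ex.
  apply RInt_ext. intros t _. unfold scal; simpl; unfold mult; simpl. ring.
Qed.

Lemma wint_0 T : wint T (fun _ => 0) = 0.
Proof.
  transitivity (0 * wint T (fun _ => 0)); [|ring].
  rewrite <- wint_scal.
  - apply wint_ext; intros; ring.
  - apply continuity_const; now intros x y.
Qed.

Lemma wint_psum T (f : nat -> R -> R) K : (forall i, continuity (f i)) ->
  wint T (fun t => psum (fun i => f i t) K) = psum (fun i => wint T (f i)) K.
Proof.
  intros H; induction K as [|K IH]; simpl.
  - apply wint_0.
  - rewrite wint_plus, IH; auto. now apply continuity_psum.
Qed.

Lemma sine_weight_bounds T t : 0 < T -> 0 <= t <= T -> 0 <= sin (PI * t / T) <= 1.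
Proof.
  intros HT Ht. split; [|apply SIN_bound].
  apply sin_ge_0; pose proof PI_RGT_0.
  - apply Rmult_le_pos; [nra|]. left; now apply Rinv_0_lt_compat.
  - apply (Rmult_le_reg_r T); [lra|].
    replace (PI * t / T * T) with (PI * t) by (field; lra). nra.
Qed.

Lemma wint_le T f g : 0 < T -> continuity f -> continuity g ->
  (forall t, 0 <= t <= T -> f t <= g t) -> wint T f <= wint T g.
Proof.
  intros HT Hf Hg H. apply RInt_le; [lra|now apply wint_ex|now apply wint_ex|].
  intros t Ht. apply Rmult_le_compat_l; [apply sine_weight_bounds; lra|apply H; lra].
Qed.

Lemma wint_le_const T f B : 0 < T -> continuity f -> 0 <= B ->
  (forall t, 0 <= t <= T -> f t <= B) -> wint T f <= T * B.
Proof.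
  intros HT Hf HB H.
  replace (T * B) with (RInt (fun _ => B) 0 T)
    by (rewrite RInt_const; unfold scal; simpl; unfold mult; simpl; ring).
  apply RInt_le; [lra|now apply wint_ex|apply ex_RInt_const|].
  intros t Ht. pose proof (sine_weight_bounds T t HT). specialize (H t). nra.
Qed.

Lemma wint_ge_0 T f : 0 < T -> continuity f ->
  (forall t, 0 <= t <= T -> 0 <= f t) -> 0 <= wint T f.
Proof.
  intros HT Hf H.
  rewrite <- (wint_0 T). apply wint_le; auto.
  apply continuity_const; now intros x y.
Qed.

(** The difference vanishes at 0 and its derivative [s * (cos (s u) - cos u)] is nonnegative,
    because cosine decreases on [[0, PI]]. *)
Lemma sin_scale s x : 0 <= s <= 1 -> 0 <= x <= PI -> s * sin x <= sin (s * x).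
Proof.
  intros Hs Hx.
  destruct (Req_dec x 0) as [->|Hx0]; [rewrite Rmult_0_r, sin_0; lra|].
  destruct (MVT_gen (fun u => sin (s * u) - s * sin u) 0 x
              (fun u => s * (cos (s * u) - cos u))) as (c & Hc & E).
  - intros u _. auto_derive; auto. ring.
  - intros u _. apply (derivable_continuity (fun v => sin (s * v) - s * sin v)).
    intros v; auto_derive; auto.
  - rewrite Rmin_left, Rmax_right in Hc by lra.
    rewrite Rmult_0_r, sin_0 in E.
    assert (cos c <= cos (s * c)) by (apply cos_decr_1; nra).
    assert (0 <= s * (cos (s * c) - cos c)) by (apply Rmult_le_pos; lra). nra.
Qed.

Lemma wint_horizon_mono T1 T f : 0 < T1 <= T -> continuity f -> (forall t, 0 <= f t) ->
  T1 / T * wint T1 f <= wint T f.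
Proof.
  intros HT Hf Hpos.
  rewrite <- wint_scal by auto.
  assert (Hr : 0 <= T1 / T <= 1).
  { split; [apply Rlt_le, Rdiv_lt_0_compat; lra|].
    apply (Rmult_le_reg_r T); [lra|]. unfold Rdiv. rewrite Rmult_assoc, Rinv_l; lra. }
  apply Rle_trans with (RInt (fun t => sin (PI * t / T) * f t) 0 T1).
  - apply RInt_le; [lra| |apply continuity_ex_RInt|].
    + apply wint_ex. apply (continuity_scal f); exact Hf.
    + apply (continuity_mult _ f); [apply sine_weight_continuity|exact Hf].
    + intros t Ht.
      replace (sin (PI * t / T1) * (T1 / T * f t))
        with (T1 / T * sin (PI * t / T1) * f t) by ring.
      apply Rmult_le_compat_r; [apply Hpos|].
      replace (PI * t / T) with (T1 / T * (PI * t / T1)) by (field; lra).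
      apply sin_scale; [exact Hr|]. pose proof PI_RGT_0. split.
      * apply Rmult_le_pos; [nra|]. left; apply Rinv_0_lt_compat; lra.
      * apply (Rmult_le_reg_r T1); [lra|].
        replace (PI * t / T1 * T1) with (PI * t) by (field; lra). nra.
  - unfold wint.
    assert (Hex : forall a b, ex_RInt (fun t => sin (PI * t / T) * f t) a b).
    { intros a b. apply continuity_ex_RInt, (continuity_mult _ f);
      [apply sine_weight_continuity|exact Hf]. }
    rewrite <- (RInt_Chasles (V := R_CompleteNormedModule) _ 0 T1 T) by apply Hex.
    unfold plus; simpl.
    assert (0 <= RInt (fun t => sin (PI * t / T) * f t) T1 T).
    { apply RInt_ge_0; [lra|apply Hex|]. intros t Ht.
      apply Rmult_le_pos; [apply sine_weight_bounds; lra|apply Hpos]. }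
    lra.
Qed.

(** Real part of [(a + i b) e^{i (x + i y) t}]; its imaginary part is [mode b (- a) x y t]. *)
Definition mode (a b x y t : R) : R := exp (- y * t) * (a * cos (x * t) - b * sin (x * t)).

Lemma mode_continuity a b x y : continuity (mode a b x y).
Proof. apply derivable_continuity; intros t; unfold mode; auto_derive; auto. Qed.

(** This is [Re z * Re z' = (Re (z z') + Re (z conj z')) / 2]. Conjugation flips the frequency but
    not the damping, so the dampings add in both terms. *)
Lemma mode_mult a b x y a' b' x' y' t :
  mode a b x y t * mode a' b' x' y' t
  = 1 / 2 * mode (a * a' - b * b') (a * b' + a' * b) (x + x') (y + y') t
    + 1 / 2 * mode (a * a' + b * b') (b * a' - a * b') (x - x') (y + y') t.
Proof.
  unfold mode.
  replace (- (y + y') * t) with (- y * t + - y' * t) by ring.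
  replace ((x + x') * t) with (x * t + x' * t) by ring.
  replace ((x - x') * t) with (x * t - x' * t) by ring.
  rewrite exp_plus, cos_plus, sin_plus, cos_minus, sin_minus. field.
Qed.

(* Real part of [(p^2 - w^2) * int sin(p t) z e^{iwt} dt = p (z + z e^{iwT})], for
   [p = PI / T], [z = a + i b] and [w = x + i y]. *)
Lemma wint_mode_identity a b x y T : 0 < T ->
  ((PI / T) ^ 2 - x ^ 2 + y ^ 2) * wint T (mode a b x y)
  + 2 * x * y * wint T (mode b (- a) x y) = PI / T * (mode a b x y T + a).
Proof.
  intros HT.
  set (p := PI / T).
  rewrite <- !wint_scal by apply mode_continuity.
  rewrite <- wint_plus by (apply continuity_scal, mode_continuity).
  (* With [f] the mode, this is [sin(p t) f' - p cos(p t) f], whose derivative is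
     [sin(p t) (f'' + p^2 f)]. The sine vanishes at both ends, so only the cosine part reaches the
     boundary. *)
  set (H := fun t => sin (PI * t / T) * (- y * mode a b x y t - x * mode b (- a) x y t)
                  - p * cos (PI * t / T) * mode a b x y t).
  transitivity (H T - H 0).
  - apply is_RInt_unique.
    apply (is_RInt_derive (V := R_CompleteNormedModule) H).
    + intros t _. unfold H, mode, p. auto_derive; auto. unfold Rdiv; ring.
    + intros t _. apply continuity_pt_filterlim.
      apply derivable_continuity; intros s; unfold mode; auto_derive; auto.
  - unfold H.
    replace (PI * T / T) with PI by (field; lra).
    replace (PI * 0 / T) with 0 by (field; lra).
    rewrite sin_PI, cos_PI, sin_0, cos_0.
    replace (mode a b x y 0) with a
      by (unfold mode; rewrite !Rmult_0_r, exp_0, sin_0, cos_0; ring).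
    ring.
Qed.

Lemma wint_mode_opp a b x y T : wint T (mode (- a) (- b) x y) = - wint T (mode a b x y).
Proof.
  replace (- wint T (mode a b x y)) with (-1 * wint T (mode a b x y)) by ring.
  rewrite <- wint_scal by apply mode_continuity.
  apply wint_ext; intros t. unfold mode. ring.
Qed.

(** Squared form of [|z + z e^{iwT}| <= |z| (1 + |e^{iwT}|)]. *)
Lemma mode_boundary a b x y T :
  (mode a b x y T + a) ^ 2 + (mode b (- a) x y T + b) ^ 2
  <= (a ^ 2 + b ^ 2) * (1 + exp (- y * T)) ^ 2.
Proof.
  unfold mode. set (e := exp (- y * T)).
  assert (He : 0 < e) by apply exp_pos.
  pose proof (sin2_cos2 (x * T)) as Hsc. unfold Rsqr in Hsc.
  pose proof (COS_bound (x * T)) as Hc.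
  set (c := cos (x * T)) in *. set (s := sin (x * T)) in *.
  replace ((e * (a * c - b * s) + a) ^ 2 + (e * (b * c - - a * s) + b) ^ 2)
    with ((a ^ 2 + b ^ 2) * (e ^ 2 * (s * s + c * c) + 2 * e * c + 1)) by ring.
  rewrite Hsc.
  apply Rmult_le_compat_l; [|nra].
  pose proof (pow2_ge_0 a); pose proof (pow2_ge_0 b); lra.
Qed.

(** Bounding the real integral alone would leave the coupling with its imaginary companion [J'];
    taking the modulus of the complex identity removes it. *)
Lemma wint_mode_bound a b x y T : 0 < T -> (PI / T) ^ 2 < x ^ 2 ->
  Rabs (wint T (mode a b x y))
  <= PI / T * sqrt (a ^ 2 + b ^ 2) * (1 + exp (- y * T)) / (x ^ 2 - (PI / T) ^ 2).
Proof.
  intros HT Hx.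
  pose proof (wint_mode_identity a b x y T HT) as I1.
  pose proof (wint_mode_identity b (- a) x y T HT) as I2.
  rewrite wint_mode_opp in I2.
  pose proof (mode_boundary a b x y T) as HB.
  assert (Hp : 0 < PI / T) by (apply Rdiv_lt_0_compat; [apply PI_RGT_0|lra]).
  pose proof (exp_pos (- y * T)) as He.
  set (p := PI / T) in *. set (e := exp (- y * T)) in *.
  set (J := wint T (mode a b x y)) in *.
  set (J' := wint T (mode b (- a) x y)) in *.
  set (u := mode a b x y T + a) in *. set (v := mode b (- a) x y T + b) in *.
  set (n := a ^ 2 + b ^ 2) in *.
  assert (Hn : 0 <= n) by (unfold n; pose proof (pow2_ge_0 a); pose proof (pow2_ge_0 b); lra).
  set (P := p ^ 2 - x ^ 2 + y ^ 2) in *.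
  assert (E : (J ^ 2 + J' ^ 2) * (P ^ 2 + (2 * x * y) ^ 2) = p ^ 2 * (u ^ 2 + v ^ 2)).
  { replace (p ^ 2 * (u ^ 2 + v ^ 2)) with ((p * u) ^ 2 + (p * v) ^ 2) by ring.
    rewrite <- I1, <- I2. ring. }
  (* The right side is [|p^2 - w^2|^2]; the damping [y] can only increase it. *)
  assert (HQ : (x ^ 2 - p ^ 2) ^ 2 <= P ^ 2 + (2 * x * y) ^ 2).
  { replace (P ^ 2 + (2 * x * y) ^ 2)
      with ((x ^ 2 + y ^ 2 - p ^ 2) ^ 2 + 4 * p ^ 2 * y ^ 2) by (unfold P; ring).
    pose proof (pow2_ge_0 y). pose proof (pow2_ge_0 p).
    assert (0 <= p ^ 2 * y ^ 2) by (apply Rmult_le_pos; lra).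
    assert ((x ^ 2 - p ^ 2) ^ 2 <= (x ^ 2 + y ^ 2 - p ^ 2) ^ 2) by (apply pow_incr; lra).
    lra. }
  assert (HJ : (J * (x ^ 2 - p ^ 2)) ^ 2 <= (p * sqrt n * (1 + e)) ^ 2).
  { replace ((p * sqrt n * (1 + e)) ^ 2) with (p ^ 2 * ((sqrt n) ^ 2 * (1 + e) ^ 2)) by ring.
    rewrite pow2_sqrt by exact Hn.
    apply Rle_trans with (p ^ 2 * (u ^ 2 + v ^ 2)).
    - rewrite <- E, Rpow_mult_distr. pose proof (pow2_ge_0 J). pose proof (pow2_ge_0 J').
      apply Rmult_le_compat; try apply pow2_ge_0; lra.
    - apply Rmult_le_compat_l; [apply pow2_ge_0|exact HB]. }
  apply (Rmult_le_reg_r (x ^ 2 - p ^ 2)); [lra|].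
  replace (p * sqrt n * (1 + e) / (x ^ 2 - p ^ 2) * (x ^ 2 - p ^ 2))
    with (p * sqrt n * (1 + e)) by (field; lra).
  rewrite <- (Rabs_pos_eq (x ^ 2 - p ^ 2)) by lra.
  rewrite <- Rabs_mult.
  rewrite <- (Rabs_pos_eq (p * sqrt n * (1 + e))).
  - apply Rsqr_le_abs_0. rewrite !Rsqr_pow2. exact HJ.
  - apply Rmult_le_pos; [apply Rmult_le_pos; [lra|apply sqrt_pos]|lra].
Qed.

Lemma wint_mode_at_0 a b y T : 0 < T ->
  ((PI / T) ^ 2 + y ^ 2) * wint T (mode a b 0 y) = PI / T * (1 + exp (- y * T)) * a.
Proof.
  intros HT. pose proof (wint_mode_identity a b 0 y T HT) as I.
  replace (mode a b 0 y T) with (exp (- y * T) * a) in I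
    by (unfold mode; rewrite Rmult_0_l, cos_0, sin_0; ring).
  replace ((PI / T) ^ 2 - 0 ^ 2 + y ^ 2) with ((PI / T) ^ 2 + y ^ 2) in I by ring.
  lra.
Qed.

(** * Ingham inequalities *)

Lemma exp_le_compat u v : u <= v -> exp u <= exp v.
Proof. intros [H| ->]; [left; now apply exp_increasing|right; reflexivity]. Qed.

(* [g / 2 <= x 0] makes the symmetric family of all [x i] and [- x i] have gap [g]. *)
Definition gapped (x : nat -> R) (g : R) : Prop :=
  g / 2 <= x 0%nat /\ forall i, x i + g <= x (S i).

Lemma gapped_diff x g i k : gapped x g -> x i + g * INR k <= x (i + k)%nat.
Proof.
  intros [_ H]. induction k as [|k IH].
  - rewrite Nat.add_0_r. simpl. lra.
  - rewrite S_INR, Nat.add_succ_r. specialize (H (i + k)%nat). lra.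
Qed.

Lemma gapped_diff_sq x g i j : 0 < g -> gapped x g ->
  g ^ 2 * (INR i - INR j) ^ 2 <= (x i - x j) ^ 2.
Proof.
  intros Hg H.
  assert (W : forall i j, (i <= j)%nat -> g ^ 2 * (INR j - INR i) ^ 2 <= (x j - x i) ^ 2).
  { clear i j. intros i j Hij.
    pose proof (gapped_diff x g i (j - i) H) as D.
    rewrite minus_INR in D by exact Hij.
    replace (i + (j - i))%nat with j in D by lia.
    apply le_INR in Hij. rewrite <- Rpow_mult_distr. apply pow_incr.
    split; [apply Rmult_le_pos; lra|lra]. }
  destruct (Nat.le_ge_cases i j) as [h|h]; [|now apply W].
  replace ((INR i - INR j) ^ 2) with ((INR j - INR i) ^ 2) by ring.
  replace ((x i - x j) ^ 2) with ((x j - x i) ^ 2) by ring. now apply W.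
Qed.

Lemma gapped_ge x g i : gapped x g -> g * (INR i + 1 / 2) <= x i.
Proof.
  intros H. pose proof (gapped_diff x g 0 i H) as D. destruct H as [H _].
  simpl in D. lra.
Qed.

Lemma gapped_sum_sq x g i j : 0 < g -> gapped x g ->
  g ^ 2 * (INR i + INR j + 1) ^ 2 <= (x i + x j) ^ 2.
Proof.
  intros Hg H.
  pose proof (gapped_ge x g i H). pose proof (gapped_ge x g j H).
  pose proof (pos_INR i). pose proof (pos_INR j).
  rewrite <- Rpow_mult_distr. apply pow_incr. split; [apply Rmult_le_pos; lra|lra].
Qed.

Lemma gapped_shift x g K : 0 < g -> gapped x g -> gapped (fun i => x (K + i)%nat) g.
Proof.
  intros Hg H. split.
  - rewrite Nat.add_0_r. pose proof (gapped_ge x g K H). pose proof (pos_INR K). nra.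
  - intros i. rewrite Nat.add_succ_r. apply H.
Qed.

(** Value of the integral of [sin (PI t / T) * exp (- 2 y t)] over [[0, T]]: the resonant part of
    the square of a mode of damping [y]. *)
Definition diag_gain (T y : R) : R :=
  PI / T * (1 + exp (- (2 * y) * T)) / ((PI / T) ^ 2 + (2 * y) ^ 2).

(** What remains of the bound in [wint_mode_bound] for a product of two modes of damping at most
    [Y], once the amplitudes and the kernel entry are factored out. *)
Definition offdiag_cost (T g Y : R) : R := 4 * (PI / T) * (1 + exp (2 * Y * T)) / g ^ 2.

(** [J] stands for the square of an integer distance between frequencies. As [PI / T <= g / 2], the
    denominator [x^2 - (PI / T)^2] is at least [(g^2 / 4) (4 J - 1)], which produces the entries of
    [ingham_kernel]. *)
Lemma wint_mode_gap_bound a b x y T g Y J : 0 < T -> 0 < g -> 2 * (PI / T) <= g ->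
  Rabs y <= 2 * Y -> 1 <= J -> g ^ 2 * J <= x ^ 2 ->
  Rabs (wint T (mode a b x y)) <= offdiag_cost T g Y * (sqrt (a ^ 2 + b ^ 2) * / (4 * J - 1)).
Proof.
  intros HT Hg Hpg Hy HJ Hx.
  assert (Hp : 0 < PI / T) by (apply Rdiv_lt_0_compat; [apply PI_RGT_0|lra]).
  set (p := PI / T) in *.
  assert (Hd : g ^ 2 / 4 * (4 * J - 1) <= x ^ 2 - p ^ 2).
  { assert (p ^ 2 <= (g / 2) ^ 2) by (apply pow_incr; lra). nra. }
  assert (Hpos : 0 < g ^ 2 / 4 * (4 * J - 1)).
  { apply Rmult_lt_0_compat; [|lra]. assert (0 < g ^ 2) by (apply pow_lt; lra). lra. }
  eapply Rle_trans; [apply wint_mode_bound; [exact HT|]|]; fold p; [lra|].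
  replace (offdiag_cost T g Y * (sqrt (a ^ 2 + b ^ 2) * / (4 * J - 1)))
    with (p * sqrt (a ^ 2 + b ^ 2) * (1 + exp (2 * Y * T)) * / (g ^ 2 / 4 * (4 * J - 1)))
    by (unfold offdiag_cost; fold p; field; split; lra).
  pose proof (exp_pos (- y * T)). pose proof (sqrt_pos (a ^ 2 + b ^ 2)).
  unfold Rdiv. apply Rmult_le_compat.
  - apply Rmult_le_pos; [apply Rmult_le_pos|]; lra.
  - left; apply Rinv_0_lt_compat; lra.
  - apply Rmult_le_compat_l; [apply Rmult_le_pos; lra|].
    apply Rplus_le_compat_l.
    apply exp_le_compat, Rmult_le_compat_r; [lra|].
    apply Rabs_le_between in Hy. lra.
  - apply Rinv_le_contravar; lra.
Qed.

Lemma offdiag_cost_ge_0 T g Y : 0 < T -> 0 < g -> 0 <= offdiag_cost T g Y.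
Proof.
  intros HT Hg. unfold offdiag_cost. pose proof (exp_pos (2 * Y * T)).
  assert (0 < PI / T) by (apply Rdiv_lt_0_compat; [apply PI_RGT_0|lra]).
  apply Rmult_le_pos; [|left; apply Rinv_0_lt_compat, pow_lt; lra].
  apply Rmult_le_pos; lra.
Qed.

Definition amp (a b : R) : R := sqrt (a ^ 2 + b ^ 2).

Lemma amp_sq a b : amp a b ^ 2 = a ^ 2 + b ^ 2.
Proof.
  apply pow2_sqrt. pose proof (pow2_ge_0 a); pose proof (pow2_ge_0 b); lra.
Qed.

Section Ingham.
Variables (T g Y : R) (x y a b : nat -> R).
Hypotheses (HT : 0 < T) (Hg : 0 < g) (HTg : 2 * (PI / T) <= g)
  (Hx : gapped x g) (Hy : forall i, Rabs (y i) <= Y).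

Let f i := mode (a i) (b i) (x i) (y i).
Let e i := amp (a i) (b i).

(** Sum frequencies are never resonant. A difference frequency is resonant only for [i = j], where
    its integral is computed exactly and subtracted. *)
Lemma wint_mode_mult_bound i j :
  Rabs (wint T (fun t => f i t * f j t)
        - (if Nat.eqb i j then 1 / 2 * diag_gain T (y i) * e i ^ 2 else 0))
  <= offdiag_cost T g Y / 2 * (e i * e j * ingham_kernel i j).
Proof.
  unfold f.
  rewrite (wint_ext _ _ _ (mode_mult (a i) (b i) (x i) (y i) (a j) (b j) (x j) (y j))).
  rewrite wint_plus, !wint_scal
    by (try apply continuity_scal; apply mode_continuity).
  assert (Hsum : Rabs (y i + y j) <= 2 * Y).
  { eapply Rle_trans; [apply Rabs_triang|]. pose proof (Hy i). pose proof (Hy j). lra. }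
  (* The modulus is multiplicative, both for [z z'] and for [z conj z']. *)
  assert (Ee : forall u v, u ^ 2 + v ^ 2 = e i ^ 2 * e j ^ 2 -> sqrt (u ^ 2 + v ^ 2) = e i * e j).
  { intros u v ->. replace (e i ^ 2 * e j ^ 2) with ((e i * e j) ^ 2) by ring.
    apply sqrt_pow2. apply Rmult_le_pos; apply sqrt_pos. }
  assert (H1 : Rabs (wint T (mode (a i * a j - b i * b j) (a i * b j + a j * b i)
                               (x i + x j) (y i + y j)))
     <= offdiag_cost T g Y * (e i * e j * / (4 * (INR i + INR j + 1) ^ 2 - 1))).
  { rewrite <- (Ee (a i * a j - b i * b j) (a i * b j + a j * b i))
      by (unfold e; rewrite !amp_sq; ring).
    apply wint_mode_gap_bound; auto; [|now apply gapped_sum_sq].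
    pose proof (pos_INR i). pose proof (pos_INR j). nra. }
  unfold ingham_kernel. destruct (Nat.eqb_spec i j) as [<-|Hij].
  - replace (x i - x i) with 0 by ring.
    assert (H2 : wint T (mode (a i * a i + b i * b i) (b i * a i - a i * b i) 0 (y i + y i))
                 = diag_gain T (y i) * e i ^ 2).
    { pose proof (wint_mode_at_0 (a i * a i + b i * b i) (b i * a i - a i * b i)
                    (y i + y i) T HT) as I.
      unfold diag_gain, e. rewrite amp_sq.
      replace (y i + y i) with (2 * y i) in * by ring.
      assert (0 < PI / T) by (apply Rdiv_lt_0_compat; [apply PI_RGT_0|lra]).
      pose proof (pow2_ge_0 (2 * y i)).
      apply (Rmult_eq_reg_l ((PI / T) ^ 2 + (2 * y i) ^ 2)); [|nra].
      rewrite I. set (p := PI / T) in *. field. nra. }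
    rewrite H2.
    match goal with |- Rabs (1 / 2 * ?A + 1 / 2 * ?B - 1 / 2 * ?c * ?d) <= _ =>
      replace (1 / 2 * A + 1 / 2 * B - 1 / 2 * c * d) with (1 / 2 * A) by ring end.
    rewrite Rabs_mult, (Rabs_pos_eq (1 / 2)) by lra.
    replace (4 * (INR i - INR i) ^ 2 - 1) with (-1) by ring.
    replace (/ -1 + / (4 * (INR i + INR i + 1) ^ 2 - 1) + 1)
      with (/ (4 * (INR i + INR i + 1) ^ 2 - 1)).
    + lra.
    + replace (/ -1) with (-1) by field. ring.
  - assert (H2 : Rabs (wint T (mode (a i * a j + b i * b j) (b i * a j - a i * b j)
                                 (x i - x j) (y i + y j)))
       <= offdiag_cost T g Y * (e i * e j * / (4 * (INR i - INR j) ^ 2 - 1))).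
    { rewrite <- (Ee (a i * a j + b i * b j) (b i * a j - a i * b j))
        by (unfold e; rewrite !amp_sq; ring).
      apply wint_mode_gap_bound; auto; [now apply INR_diff_sq|now apply gapped_diff_sq]. }
    rewrite Rminus_0_r. eapply Rle_trans; [apply Rabs_triang|].
    rewrite !Rabs_mult, (Rabs_pos_eq (1 / 2)) by lra. lra.
Qed.

Lemma ingham_form K :
  Rabs (wint T (fun t => psum (fun i => f i t) K ^ 2)
        - psum (fun i => 1 / 2 * diag_gain T (y i) * e i ^ 2) K)
  <= offdiag_cost T g Y / 2 * psum (fun i => e i ^ 2) K.
Proof.
  assert (Hc : forall i, continuity (f i)) by (intros; apply mode_continuity).
  rewrite (wint_ext T _ (fun t => psum (fun i => psum (fun j => f i t * f j t) K) K))
    by (intros; apply psum_square).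
  rewrite (wint_psum T (fun i t => psum (fun j => f i t * f j t) K)).
  2:{ intros i. apply (continuity_psum (fun j t => f i t * f j t)).
      intros j. now apply (continuity_mult (f i) (f j)). }
  rewrite (psum_ext _ (fun i => psum (fun j => wint T (fun t => f i t * f j t)) K)).
  2:{ intros i _. apply (wint_psum T (fun j t => f i t * f j t)).
      intros j. now apply (continuity_mult (f i) (f j)). }
  (* The diagonal becomes a double sum, so that it can be subtracted entry by entry before the Schur
     test. *)
  rewrite (psum_ext (fun i => 1 / 2 * diag_gain T (y i) * e i ^ 2)
    (fun i => psum (fun j => if Nat.eqb i j then 1 / 2 * diag_gain T (y i) * e i ^ 2 else 0) K)).
  2:{ intros i Hi. rewrite (psum_kronecker (fun _ => 1 / 2 * diag_gain T (y i) * e i ^ 2)).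
      now destruct (Nat.ltb_spec i K); [|lia]. }
  match goal with |- Rabs (psum ?F K - psum ?G K) <= _ =>
    replace (psum F K - psum G K) with (psum (fun i => F i + -1 * G i) K)
      by (rewrite psum_plus, psum_scal; ring) end.
  eapply Rle_trans; [apply psum_Rabs|].
  apply Rle_trans with (psum (fun i => psum (fun j =>
     offdiag_cost T g Y / 2 * (e i * e j * ingham_kernel i j)) K) K).
  - apply psum_le; intros i _.
    rewrite <- psum_scal, <- psum_plus.
    eapply Rle_trans; [apply psum_Rabs|]. apply psum_le; intros j _.
    eapply Rle_trans; [|apply wint_mode_mult_bound].
    right. f_equal. ring.
  - rewrite (psum_ext _ (fun i => offdiag_cost T g Y / 2 *
        psum (fun j => e i * e j * ingham_kernel i j) K))
      by (intros; apply psum_scal).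
    rewrite psum_scal. apply Rmult_le_compat_l.
    + pose proof (offdiag_cost_ge_0 T g Y HT Hg). lra.
    + rewrite <- (Rmult_1_l (psum (fun i => e i ^ 2) K)).
      apply psum_schur; [exact ingham_kernel_ge_0|exact ingham_kernel_sym|].
      intros i Hi. now apply ingham_kernel_row.
Qed.

Lemma ingham_lower K q : (forall i, q <= diag_gain T (y i)) ->
  (q - offdiag_cost T g Y) / 2 * psum (fun i => e i ^ 2) K
  <= wint T (fun t => psum (fun i => f i t) K ^ 2).
Proof.
  intros Hq. pose proof (ingham_form K) as H.
  assert (q / 2 * psum (fun i => e i ^ 2) K
          <= psum (fun i => 1 / 2 * diag_gain T (y i) * e i ^ 2) K).
  { rewrite <- psum_scal. apply psum_le; intros i _.
    apply Rmult_le_compat_r; [apply pow2_ge_0|]. specialize (Hq i). lra. }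
  apply Rabs_le_between in H. lra.
Qed.

(** Dropping [(2 * y i) ^ 2] from the denominator of the gain bounds it by
    [(1 + exp (2 * Y * T)) / (PI / T)]. *)
Lemma ingham_upper K :
  wint T (fun t => psum (fun i => f i t) K ^ 2)
  <= ((1 + exp (2 * Y * T)) / (PI / T) + offdiag_cost T g Y) / 2 * psum (fun i => e i ^ 2) K.
Proof.
  pose proof (ingham_form K) as H.
  assert (psum (fun i => 1 / 2 * diag_gain T (y i) * e i ^ 2) K
          <= (1 + exp (2 * Y * T)) / (PI / T) / 2 * psum (fun i => e i ^ 2) K).
  { rewrite <- psum_scal. apply psum_le; intros i _.
    apply Rmult_le_compat_r; [apply pow2_ge_0|].
    assert (Hp : 0 < PI / T) by (apply Rdiv_lt_0_compat; [apply PI_RGT_0|lra]).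
    unfold diag_gain. set (p := PI / T) in *.
    assert (Hexp : exp (- (2 * y i) * T) <= exp (2 * Y * T)).
    { apply exp_le_compat. apply Rmult_le_compat_r; [lra|].
      pose proof (Hy i) as h. apply Rabs_le_between in h. lra. }
    pose proof (exp_pos (- (2 * y i) * T)).
    replace ((1 + exp (2 * Y * T)) / p) with (p * (1 + exp (2 * Y * T)) / p ^ 2) by (field; lra).
    assert (p * (1 + exp (- (2 * y i) * T)) / (p ^ 2 + (2 * y i) ^ 2)
            <= p * (1 + exp (2 * Y * T)) / p ^ 2); [|lra].
    assert (0 < p ^ 2) by (apply pow_lt; lra). pose proof (pow2_ge_0 (2 * y i)).
    unfold Rdiv. apply Rmult_le_compat.
    - apply Rmult_le_pos; lra.
    - left; apply Rinv_0_lt_compat; lra.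
    - apply Rmult_le_compat_l; lra.
    - apply Rinv_le_contravar; lra. }
  apply Rabs_le_between in H. lra.
Qed.
End Ingham.

(** * Convergence and constants *)

(** The two sides differ by the square [/ d * (d * v - (u - v)) ^ 2]. With [d] small this does the
    work of the triangle inequality in weighted [L^2]. *)
Lemma sq_perturb u v d : 0 < d -> u ^ 2 <= (1 + d) * v ^ 2 + (1 + / d) * (u - v) ^ 2.
Proof.
  intros Hd.
  assert (0 <= / d * (d * v - (u - v)) ^ 2)
    by (apply Rmult_le_pos; [left; now apply Rinv_0_lt_compat|apply pow2_ge_0]).
  replace (/ d * (d * v - (u - v)) ^ 2)
    with (d * v ^ 2 - 2 * v * (u - v) + / d * (u - v) ^ 2) in H by (field; lra).
  nra.
Qed.

Lemma wint_sq_perturb T f g d : 0 < T -> continuity f -> continuity g -> 0 < d ->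
  wint T (fun t => f t ^ 2)
  <= (1 + d) * wint T (fun t => g t ^ 2) + (1 + / d) * wint T (fun t => (f t - g t) ^ 2).
Proof.
  intros HT Hf Hg Hd.
  assert (Hg2 := continuity_sq g Hg).
  assert (Hd2 := continuity_sq (fun t => f t - g t) (continuity_minus f g Hf Hg)).
  assert (H1 := continuity_scal (fun t => g t ^ 2) (1 + d) Hg2).
  assert (H2 := continuity_scal (fun t => (f t - g t) ^ 2) (1 + / d) Hd2).
  rewrite <- !wint_scal by assumption.
  rewrite <- wint_plus by assumption.
  apply wint_le; auto.
  - now apply continuity_sq.
  - exact (continuity_plus _ _ H1 H2).
  - intros t _. now apply sq_perturb.
Qed.

Lemma psum_partial_le w W K : (forall i, 0 <= w i) -> Un_cv (psum w) W -> psum w K <= W.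
Proof.
  intros Hw HW. apply (growing_ineq (psum w)); [|exact HW].
  intros n. simpl. specialize (Hw n). lra.
Qed.

(* The partial sums are Cauchy in the weighted [L^2] space, hence so are their squared norms. *)
Lemma wint_square_cv T (v : nat -> R -> R) (w : nat -> R) W Q :
  0 < T -> (forall i, continuity (v i)) -> (forall i, 0 <= w i) -> Un_cv (psum w) W ->
  0 <= Q ->
  (forall K L, wint T (fun t => psum (fun i => v (K + i)%nat t) L ^ 2)
               <= Q * psum (fun i => w (K + i)%nat) L) ->
  exists l, Un_cv (fun K => wint T (fun t => psum (fun i => v i t) K ^ 2)) l.
Proof.
  intros HT Hv Hw HW HQ H.
  set (G := fun K => wint T (fun t => psum (fun i => v i t) K ^ 2)).
  assert (Hc : forall K, continuity (fun t => psum (fun i => v i t) K))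
    by (intros K; now apply continuity_psum).
  assert (HW0 : 0 <= W) by exact (psum_partial_le w W 0 Hw HW).
  assert (HG : forall K, G K <= Q * W).
  { intros K. eapply Rle_trans; [apply (H 0%nat K)|].
    apply Rmult_le_compat_l; [exact HQ|]. now apply (psum_partial_le w W K). }
  assert (Hstep : forall d K L, 0 < d ->
            Rabs (G (K + L)%nat - G K) <= d * (Q * W) + (1 + / d) * (Q * (W - psum w K))).
  { intros d K L Hd.
    assert (Hdi : 0 < / d) by now apply Rinv_0_lt_compat.
    assert (Htail : wint T (fun t => psum (fun i => v (K + i)%nat t) L ^ 2)
                    <= Q * (W - psum w K)).
    { eapply Rle_trans; [apply H|]. apply Rmult_le_compat_l; [exact HQ|].
      pose proof (psum_partial_le w W (K + L) Hw HW) as h. rewrite psum_add in h. lra. }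
    pose proof (wint_sq_perturb T _ _ d HT (Hc (K + L)%nat) (Hc K) Hd) as A1.
    pose proof (wint_sq_perturb T _ _ d HT (Hc K) (Hc (K + L)%nat) Hd) as A2.
    cbv beta in A1, A2.
    rewrite (wint_ext T (fun t => (psum (fun i => v i t) (K + L) - psum (fun i => v i t) K) ^ 2)
               (fun t => psum (fun i => v (K + i)%nat t) L ^ 2)) in A1
      by (intros t; rewrite psum_add; ring).
    rewrite (wint_ext T (fun t => (psum (fun i => v i t) K - psum (fun i => v i t) (K + L)) ^ 2)
               (fun t => psum (fun i => v (K + i)%nat t) L ^ 2)) in A2
      by (intros t; rewrite psum_add; ring).
    fold (G K) (G (K + L)%nat) in A1, A2.
    pose proof (HG K). pose proof (HG (K + L)%nat).
    set (V := wint T (fun t => psum (fun i => v (K + i)%nat t) L ^ 2)) in *.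
    assert (d * G K <= d * (Q * W)) by (apply Rmult_le_compat_l; lra).
    assert (d * G (K + L)%nat <= d * (Q * W)) by (apply Rmult_le_compat_l; lra).
    assert ((1 + / d) * V <= (1 + / d) * (Q * (W - psum w K)))
      by (apply Rmult_le_compat_l; lra).
    apply Rabs_le. lra. }
  destruct (R_complete G) as [l Hl]; [|now exists l].
  assert (Hcauchy : forall e, 0 < e -> exists N, forall n, (n >= N)%nat -> Rabs (G n - G N) < e).
  { intros e He.
    assert (HQW : 0 <= Q * W) by (apply Rmult_le_pos; lra).
    (* The added 1, here and in [c] below, keeps the divisions meaningful when [Q * W] or [Q]
       vanishes. *)
    set (d := e / (2 * (Q * W + 1))).
    assert (Hd : 0 < d) by (apply Rdiv_lt_0_compat; lra).
    assert (Hdi : 0 < / d) by now apply Rinv_0_lt_compat.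
    set (c := (1 + / d) * (Q + 1)).
    assert (Hcpos : 0 < c) by (apply Rmult_lt_0_compat; lra).
    destruct (HW (e / (2 * c))) as [N HN]; [apply Rdiv_lt_0_compat; lra|].
    exists N. intros n Hn. replace n with (N + (n - N))%nat by lia.
    eapply Rle_lt_trans; [apply (Hstep d N (n - N)%nat Hd)|].
    specialize (HN N (Nat.le_refl N)). unfold R_dist in HN. apply Rabs_def2 in HN.
    pose proof (psum_partial_le w W N Hw HW).
    assert (d * (Q * W) < e / 2).
    { replace (e / 2) with (d * (Q * W + 1)) by (unfold d; field; lra). nra. }
    assert ((1 + / d) * (Q * (W - psum w N)) <= c * (W - psum w N)).
    { unfold c. rewrite Rmult_assoc. apply Rmult_le_compat_l; [lra|].
      apply Rmult_le_compat_r; lra. }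
    assert (c * (W - psum w N) < e / 2).
    { replace (e / 2) with (c * (e / (2 * c))) by (field; lra).
      apply Rmult_lt_compat_l; lra. }
    lra. }
  intros e He. destruct (Hcauchy (e / 2)) as [N HN]; [lra|].
  exists N. intros n m Hn Hm. unfold R_dist.
  replace (G n - G m) with ((G n - G N) - (G m - G N)) by ring.
  eapply Rle_lt_trans; [apply Rabs_triang|]. rewrite Rabs_Ropp.
  pose proof (HN n Hn). pose proof (HN m Hm). lra.
Qed.

(** One step of the comparison of the sum with the integral of [x^(- 1 - a)], obtained from two uses
    of [1 + u <= exp u]: one for the increment of [ln], one for the power. *)
Lemma Rpower_telescope_step m a : (1 <= m)%nat -> 0 < a ->
  Rpower (INR (S m)) (- (1 + a)) <= / a * (Rpower (INR m) (- a) - Rpower (INR (S m)) (- a)).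
Proof.
  intros Hm Ha.
  assert (Hm1 : 1 <= INR m) by (apply (le_INR 1); lia).
  rewrite S_INR. set (x := INR m) in *.
  assert (Hln : / (x + 1) <= ln (x + 1) - ln x).
  { pose proof (exp_ineq1_le (ln x - ln (x + 1))) as E.
    replace (exp (ln x - ln (x + 1))) with (1 - / (x + 1)) in E; [lra|].
    unfold Rminus at 2. rewrite exp_plus, exp_Ropp, !exp_ln by lra. field; lra. }
  assert (Hpow : Rpower (x + 1) (- a) * (1 + a * / (x + 1)) <= Rpower x (- a)).
  { unfold Rpower.
    replace (- a * ln x) with (- a * ln (x + 1) + a * (ln (x + 1) - ln x)) by ring.
    rewrite exp_plus. apply Rmult_le_compat_l; [left; apply exp_pos|].
    eapply Rle_trans; [|apply exp_ineq1_le]. apply Rplus_le_compat_l.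
    apply Rmult_le_compat_l; lra. }
  replace (- (1 + a)) with (- a + - (1)) by ring.
  rewrite Rpower_plus, (Rpower_Ropp (x + 1) 1), Rpower_1 by lra.
  apply (Rmult_le_reg_l a); [exact Ha|].
  rewrite <- (Rmult_assoc a (/ a)), Rinv_r, Rmult_1_l by lra. lra.
Qed.

Lemma Rpower_sum_bound m a L : (1 <= m)%nat -> 0 < a ->
  psum (fun i => Rpower (INR (S m + i)) (- (1 + a))) L <= / a * Rpower (INR m) (- a).
Proof.
  intros Hm Ha.
  assert (psum (fun i => Rpower (INR (S m + i)) (- (1 + a))) L
          <= / a * (Rpower (INR m) (- a) - Rpower (INR (m + L)) (- a))) as H.
  { induction L as [|L IH]; cbn [psum].
    - rewrite Nat.add_0_r. lra.
    - pose proof (Rpower_telescope_step (m + L) a ltac:(lia) Ha) as E.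
      rewrite Nat.add_succ_r. change (S m + L)%nat with (S (m + L)). lra. }
  eapply Rle_trans; [exact H|].
  apply Rmult_le_compat_l; [left; now apply Rinv_0_lt_compat|].
  pose proof (exp_pos (- a * ln (INR (m + L)))). unfold Rpower at 2. lra.
Qed.

(** The exponentials are at most 1 because [r i <= 0], so Cauchy-Schwarz and the square summability
    of [rho] suffice; no gap is involved. *)
Lemma real_exponentials_bound (c r rho w : nat -> R) m Z t L :
  0 <= t -> 0 <= m -> (forall i, r i <= 0) -> (forall i, 0 <= w i) ->
  (forall i, Rabs (c i) <= m * rho i * sqrt (w i)) ->
  psum (fun i => rho i ^ 2) L <= Z ->
  psum (fun i => c i * exp (r i * t)) L ^ 2 <= m ^ 2 * Z * psum w L.
Proof.
  intros Ht Hm Hr Hw Hc HZ.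
  assert (H1 : Rabs (psum (fun i => c i * exp (r i * t)) L)
               <= m * psum (fun i => rho i * sqrt (w i)) L).
  { eapply Rle_trans; [apply psum_Rabs|]. rewrite <- psum_scal.
    apply psum_le; intros i _. rewrite Rabs_mult, (Rabs_pos_eq (exp _)) by (left; apply exp_pos).
    assert (exp (r i * t) <= 1).
    { rewrite <- exp_0. apply exp_le_compat. specialize (Hr i). nra. }
    specialize (Hc i). pose proof (Rabs_pos (c i)). nra. }
  apply Rle_trans with ((m * psum (fun i => rho i * sqrt (w i)) L) ^ 2).
  - rewrite <- (pow2_abs (psum (fun i => c i * exp (r i * t)) L)).
    apply pow_incr; split; [apply Rabs_pos|exact H1].
  - rewrite Rpow_mult_distr, Rmult_assoc. apply Rmult_le_compat_l; [apply pow2_ge_0|].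
    eapply Rle_trans; [apply psum_cauchy_schwarz|].
    rewrite (psum_ext (fun i => sqrt (w i) ^ 2) w) by (intros; now apply pow2_sqrt).
    apply Rmult_le_compat_r; [now apply psum_ge_0|exact HZ].
Qed.

(** The numerator decreases in [y] and the denominator is even, so [y = d] is the worst case. *)
Lemma diag_gain_mono T d y : 0 < T -> Rabs y <= d -> diag_gain T d <= diag_gain T y.
Proof.
  intros HT Hy. apply Rabs_le_between in Hy.
  assert (Hp : 0 < PI / T) by (apply Rdiv_lt_0_compat; [apply PI_RGT_0|lra]).
  unfold diag_gain. set (p := PI / T) in *.
  assert (exp (- (2 * d) * T) <= exp (- (2 * y) * T))
    by (apply exp_le_compat, Rmult_le_compat_r; lra).
  pose proof (exp_pos (- (2 * d) * T)).
  assert (y ^ 2 <= d ^ 2) by nra.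
  assert (0 < p ^ 2) by (apply pow_lt; lra). pose proof (pow2_ge_0 y).
  unfold Rdiv. apply Rmult_le_compat.
  - apply Rmult_le_pos; lra.
  - left; apply Rinv_0_lt_compat; nra.
  - apply Rmult_le_compat_l; lra.
  - apply Rinv_le_contravar; nra.
Qed.

(** With [p = PI / T], the difference at [d = 0] is [2 (g^2 - 4 p^2) / (p g^2)]: here the critical
    horizon enters. Continuity in [d] keeps it positive for a small damping. *)
Lemma gain_exceeds_cost T g : 0 < T -> 2 * (PI / T) < g ->
  exists d, 0 < d /\ offdiag_cost T g d < diag_gain T d.
Proof.
  intros HT Hg.
  assert (Hp : 0 < PI / T) by (apply Rdiv_lt_0_compat; [apply PI_RGT_0|lra]).
  set (h := fun d => diag_gain T d - offdiag_cost T g d).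
  assert (H0 : 0 < h 0).
  { unfold h, diag_gain, offdiag_cost.
    replace (- (2 * 0) * T) with 0 by ring. replace (2 * 0 * T) with 0 by ring.
    rewrite exp_0. set (p := PI / T) in *.
    replace (p * (1 + 1) / (p ^ 2 + (2 * 0) ^ 2) - 4 * p * (1 + 1) / g ^ 2)
      with (2 * (g ^ 2 - 4 * p ^ 2) / (p * g ^ 2)) by (field; lra).
    apply Rdiv_lt_0_compat; [nra|]. apply Rmult_lt_0_compat; [lra|apply pow_lt; lra]. }
  assert (Hc : continuity h).
  { apply derivable_continuity; intros d. unfold h, diag_gain, offdiag_cost.
    set (p := PI / T) in *. auto_derive.
    assert (0 < p * p) by (apply Rmult_lt_0_compat; lra).
    nra. }
  destruct (Hc 0 (h 0) H0) as (d & Hd & Hlim).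
  exists (d / 2). split; [lra|].
  specialize (Hlim (d / 2)). simpl in Hlim. unfold R_dist in Hlim.
  assert (Rabs (h (d / 2) - h 0) < h 0) as B.
  { apply Hlim. split; [split; [exact I|lra]|].
    rewrite Rminus_0_r, Rabs_pos_eq; lra. }
  apply Rabs_def2 in B. assert (Hh : 0 < h (d / 2)) by lra. unfold h in Hh. lra.
Qed.

(** * Estimates for the tails of [u1] and [u2] *)

Definition cmode (A w : Cpx) (t : R) : R := mode (Re A) (Im A) (Re w) (Im w) t.

(** [- i conj w] is the conjugate of [i w], so the second summand is the conjugate of the first. *)
Lemma cmode_conj_pair A w t :
  Cadd (Cmul A (Cexp (Cmul (Cmul Ci w) (Cof t))))
       (Cmul (Cconj A) (Cexp (Cmul (Copp (Cmul Ci (Cconj w))) (Cof t))))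
  = (2 * cmode A w t, 0).
Proof.
  destruct A as [a b], w as [x y].
  unfold Cadd, Cmul, Cexp, Cconj, Copp, Ci, Cof, cmode, mode, Re, Im; simpl.
  replace ((0 * x - 1 * y) * t - (0 * y + 1 * x) * 0) with (- y * t) by ring.
  replace ((0 * x - 1 * y) * 0 + (0 * y + 1 * x) * t) with (x * t) by ring.
  replace (- (0 * x - 1 * - y) * t - - (0 * - y + 1 * x) * 0) with (- y * t) by ring.
  replace (- (0 * x - 1 * - y) * 0 + - (0 * - y + 1 * x) * t) with (- (x * t)) by ring.
  rewrite cos_neg, sin_neg. f_equal; ring.
Qed.

Definition u1_real (om ze Cc Dc : nat -> Cpx) (Rc r : nat -> R) (n : nat) (t : R) : R :=
  2 * cmode (Cc n) (om n) t + Rc n * exp (r n * t) + 2 * cmode (Dc n) (ze n) t.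

Definition u2_real (om ze Cc Dc cc dc : nat -> Cpx) (n : nat) (t : R) : R :=
  2 * cmode (Cmul (dc n) (Dc n)) (ze n) t + 2 * cmode (Cmul (cc n) (Cc n)) (om n) t.

Lemma u1_term_real om ze Cc Dc Rc r n t :
  u1_term om ze Cc Dc Rc r n t = (u1_real om ze Cc Dc Rc r n t, 0).
Proof.
  unfold u1_term. rewrite (cmode_conj_pair (Cc n) (om n) t).
  pose proof (cmode_conj_pair (Dc n) (ze n) t) as H.
  unfold Cadd in *. simpl in *. injection H as H1 H2.
  unfold u1_real. f_equal; simpl; lra.
Qed.

Lemma u2_term_real om ze Cc Dc cc dc n t :
  u2_term om ze Cc Dc cc dc n t = (u2_real om ze Cc Dc cc dc n t, 0).
Proof.
  unfold u2_term. rewrite (cmode_conj_pair (Cmul (dc n) (Dc n)) (ze n) t).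
  pose proof (cmode_conj_pair (Cmul (cc n) (Cc n)) (om n) t) as H.
  unfold Cadd in *. simpl in *. injection H as H1 H2.
  unfold u2_real. f_equal; simpl; lra.
Qed.

Lemma Cnorm2_Csum_real (f : nat -> Cpx) (h : nat -> R) n0 K :
  (forall n, f n = (h n, 0)) ->
  Cnorm2 (Csum f n0 K) = psum (fun i => h (n0 + i)%nat) K ^ 2.
Proof.
  intros H.
  assert (E : Csum f n0 K = (psum (fun i => h (n0 + i)%nat) K, 0)).
  { induction K as [|K IH]; [reflexivity|].
    cbn [Csum psum]. rewrite IH, H. unfold Cadd; simpl. f_equal; ring. }
  rewrite E. unfold Cnorm2; simpl. ring.
Qed.

Lemma cmode_continuity A w : continuity (cmode A w).
Proof. apply mode_continuity. Qed.

Lemma u1_real_continuity om ze Cc Dc Rc r n : continuity (u1_real om ze Cc Dc Rc r n).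
Proof.
  apply derivable_continuity; intros t. unfold u1_real, cmode, mode. auto_derive; auto.
Qed.

Lemma u2_real_continuity om ze Cc Dc cc dc n : continuity (u2_real om ze Cc Dc cc dc n).
Proof.
  apply derivable_continuity; intros t. unfold u2_real, cmode, mode. auto_derive; auto.
Qed.

Lemma energy_RInt T om ze Cc Dc cc dc Rc r n0 K : 0 < T ->
  RInt_eq (energy T om ze Cc Dc cc dc Rc r n0 K) 0 T
    (wint T (fun t => psum (fun i => u1_real om ze Cc Dc Rc r (n0 + i) t) K ^ 2)
     + wint T (fun t => psum (fun i => u2_real om ze Cc Dc cc dc (n0 + i) t) K ^ 2)).
Proof.
  intros HT.
  set (f1 := fun t => psum (fun i => u1_real om ze Cc Dc Rc r (n0 + i) t) K).
  set (f2 := fun t => psum (fun i => u2_real om ze Cc Dc cc dc (n0 + i) t) K).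
  assert (H1 : continuity (fun t => f1 t ^ 2)).
  { apply continuity_sq, (continuity_psum (fun i => u1_real om ze Cc Dc Rc r (n0 + i))).
    intros; apply u1_real_continuity. }
  assert (H2 : continuity (fun t => f2 t ^ 2)).
  { apply continuity_sq, (continuity_psum (fun i => u2_real om ze Cc Dc cc dc (n0 + i))).
    intros; apply u2_real_continuity. }
  assert (E : forall t, 0 <= t <= T ->
     energy T om ze Cc Dc cc dc Rc r n0 K t = sin (PI * t / T) * (f1 t ^ 2 + f2 t ^ 2)).
  { intros t Ht. unfold energy, kw.
    destruct (Rle_dec 0 t); [|lra]. destruct (Rle_dec t T); [|lra].
    rewrite (Cnorm2_Csum_real _ (fun n => u1_real om ze Cc Dc Rc r n t))
      by (intros; apply u1_term_real).
    rewrite (Cnorm2_Csum_real _ (fun n => u2_real om ze Cc Dc cc dc n t))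
      by (intros; apply u2_term_real).
    reflexivity. }
  assert (X : ex_RInt (energy T om ze Cc Dc cc dc Rc r n0 K) 0 T).
  { apply (ex_RInt_ext (fun t => sin (PI * t / T) * (f1 t ^ 2 + f2 t ^ 2))).
    - rewrite Rmin_left, Rmax_right by lra. intros t Ht. symmetry. apply E; lra.
    - apply wint_ex, (continuity_plus _ _ H1 H2). }
  exists (ex_RInt_Reals_0 _ _ _ X). rewrite <- RInt_Reals, <- wint_plus by assumption.
  apply RInt_ext. rewrite Rmin_left, Rmax_right by lra. intros t Ht. apply E; lra.
Qed.

Lemma Cnorm2_ge_0 z : 0 <= Cnorm2 z.
Proof. unfold Cnorm2. nra. Qed.

Lemma Cnorm2_Cmul z w : Cnorm2 (Cmul z w) = Cnorm2 z * Cnorm2 w.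
Proof. unfold Cnorm2, Cmul; simpl. ring. Qed.

Lemma Cabs_sq z : Cabs z ^ 2 = Cnorm2 z.
Proof. apply pow2_sqrt, Cnorm2_ge_0. Qed.

Lemma Cabs_ge_Re z : Re z <= Cabs z.
Proof.
  destruct (Rle_dec 0 (Re z)) as [h|h].
  - apply Rsqr_incr_0_var; [|apply sqrt_pos].
    rewrite !Rsqr_pow2, Cabs_sq. unfold Cnorm2. nra.
  - pose proof (sqrt_pos (Cnorm2 z)). unfold Cabs. lra.
Qed.

Lemma amp_Cnorm2 z : amp (Re z) (Im z) ^ 2 = Cnorm2 z.
Proof. rewrite amp_sq. unfold Cnorm2. ring. Qed.

Definition upper_cost (T g Y : R) : R :=
  ((1 + exp (2 * Y * T)) / (PI / T) + offdiag_cost T g Y) / 2.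

Lemma upper_cost_ge_0 T g Y : 0 < T -> 0 < g -> 0 <= upper_cost T g Y.
Proof.
  intros HT Hg. unfold upper_cost.
  pose proof (offdiag_cost_ge_0 T g Y HT Hg). pose proof (exp_pos (2 * Y * T)).
  assert (0 < PI / T) by (apply Rdiv_lt_0_compat; [apply PI_RGT_0|lra]).
  assert (0 < (1 + exp (2 * Y * T)) / (PI / T)) by (apply Rdiv_lt_0_compat; lra). lra.
Qed.

(** The bound covers every block of indices from [K] on, with a constant independent of the block,
    as the Cauchy argument of [wint_square_cv] demands. *)
Lemma cmode_upper T g Y (A w : nat -> Cpx) (k : R) (wt : nat -> R) K L :
  0 < T -> 0 < g -> 2 * (PI / T) <= g -> gapped (fun i => Re (w i)) g ->
  (forall i, Rabs (Im (w i)) <= Y) -> (forall i, Cnorm2 (A i) <= k * wt i) ->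
  wint T (fun t => psum (fun i => cmode (A (K + i)%nat) (w (K + i)%nat) t) L ^ 2)
  <= upper_cost T g Y * k * psum (fun i => wt (K + i)%nat) L.
Proof.
  intros HT Hg HTg Hw HY HA.
  eapply Rle_trans.
  - apply (ingham_upper T g Y (fun i => Re (w (K + i)%nat)) (fun i => Im (w (K + i)%nat))
      (fun i => Re (A (K + i)%nat)) (fun i => Im (A (K + i)%nat))); auto.
    apply (gapped_shift (fun i => Re (w i))); auto.
  - fold (upper_cost T g Y). rewrite Rmult_assoc. apply Rmult_le_compat_l.
    + now apply upper_cost_ge_0.
    + rewrite <- psum_scal. apply psum_le. intros i _. rewrite amp_Cnorm2. apply HA.
Qed.

Lemma psum_scal_cmode (A v : nat -> Cpx) L t :
  psum (fun i => 2 * cmode (A i) (v i) t) L = 2 * psum (fun i => cmode (A i) (v i) t) L.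
Proof. apply psum_scal. Qed.

(** * Direct and inverse inequalities for sequences already shifted by [n0] *)

Section Tail.
Variables (om ze cc dc Cc Dc : nat -> Cpx) (Rc r rho : nat -> R) (w : nat -> R).
Variables (g Y d X M c1 mu Z : R).
Hypotheses (Hg : 0 < g) (HM : 0 < M) (Hc1 : 0 < c1) (Hmu : 0 < mu) (HX : 0 < X).
Hypotheses (Gom : gapped (fun i => Re (om i)) g) (Gze : gapped (fun i => Re (ze i)) g).
Hypotheses (Yom : forall i, Rabs (Im (om i)) <= Y) (Yze : forall i, Rabs (Im (ze i)) <= d).
Hypotheses (Xom : forall i, X <= Re (om i)) (Hr : forall i, r i <= 0).
Hypotheses (Hd : forall i, c1 * Cabs (ze i) <= Cabs (dc i))
  (Hc : forall i, Cabs (cc i) <= M / Cabs (om i)).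
Hypothesis (Hw : forall i, w i = Cnorm2 (Cc i) + Cnorm2 (Cmul (dc i) (Dc i))).
Hypothesis (HZ : forall K L, psum (fun i => rho (K + i)%nat ^ 2) L <= Z).
Hypothesis (HR : forall i, Rabs (Rc i) <= mu * rho i * sqrt (w i)).
Hypothesis (HC : forall i, Cabs (Cc i) <= M * Cabs (Cmul (dc i) (Dc i))).

Lemma tail_weight_ge_0 i : 0 <= w i.
Proof.
  rewrite Hw. pose proof (Cnorm2_ge_0 (Cc i)).
  pose proof (Cnorm2_ge_0 (Cmul (dc i) (Dc i))). lra.
Qed.

Lemma tail_norm_C i : Cnorm2 (Cc i) <= 1 * w i.
Proof. rewrite Hw. pose proof (Cnorm2_ge_0 (Cmul (dc i) (Dc i))). lra. Qed.

Lemma tail_norm_dD i : Cnorm2 (Cmul (dc i) (Dc i)) <= 1 * w i.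
Proof. rewrite Hw. pose proof (Cnorm2_ge_0 (Cc i)). lra. Qed.

Lemma tail_norm_C_dD i : Cnorm2 (Cc i) <= M ^ 2 * Cnorm2 (Cmul (dc i) (Dc i)).
Proof.
  rewrite <- !Cabs_sq, <- Rpow_mult_distr. apply pow_incr.
  split; [apply sqrt_pos|apply HC].
Qed.

(** On the tail [|d_i| >= c1 |ze_i| >= c1 Re ze_i >= c1 g / 2], so [D_i] is controlled by
    [d_i D_i]. *)
Lemma tail_norm_D i : Cnorm2 (Dc i) <= / (c1 * (g / 2)) ^ 2 * w i.
Proof.
  assert (Hq : 0 < c1 * (g / 2)) by (apply Rmult_lt_0_compat; lra).
  assert (Hq2 : 0 < (c1 * (g / 2)) ^ 2) by now apply pow_lt.
  assert (H1 : (c1 * (g / 2)) ^ 2 <= Cnorm2 (dc i)).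
  { rewrite <- Cabs_sq. apply pow_incr. split; [lra|].
    eapply Rle_trans; [|apply Hd]. apply Rmult_le_compat_l; [lra|].
    eapply Rle_trans; [|apply Cabs_ge_Re].
    pose proof (gapped_ge _ _ i Gze) as h. cbv beta in h. pose proof (pos_INR i). nra. }
  apply (Rmult_le_reg_l ((c1 * (g / 2)) ^ 2)); [exact Hq2|].
  rewrite <- Rmult_assoc, Rinv_r by lra.
  eapply Rle_trans; [|apply tail_norm_dD]. rewrite Cnorm2_Cmul.
  apply Rmult_le_compat_r; [apply Cnorm2_ge_0|exact H1].
Qed.

Lemma tail_norm_cC i : Cnorm2 (Cmul (cc i) (Cc i)) <= (M / X) ^ 2 * Cnorm2 (Cc i).
Proof.
  rewrite Cnorm2_Cmul. apply Rmult_le_compat_r; [apply Cnorm2_ge_0|].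
  rewrite <- Cabs_sq. apply pow_incr. split; [apply sqrt_pos|].
  eapply Rle_trans; [apply Hc|]. apply Rmult_le_compat_l; [lra|].
  apply Rinv_le_contravar; [exact HX|].
  eapply Rle_trans; [apply Xom|apply Cabs_ge_Re].
Qed.

Lemma tail_norm_cC_w i : Cnorm2 (Cmul (cc i) (Cc i)) <= (M / X) ^ 2 * w i.
Proof.
  eapply Rle_trans; [apply tail_norm_cC|]. apply Rmult_le_compat_l; [apply pow2_ge_0|].
  pose proof (tail_norm_C i). lra.
Qed.

Lemma u1_upper T : 0 < T -> 2 * (PI / T) <= g ->
  exists Q, 0 <= Q /\ forall K L,
  wint T (fun t => psum (fun i => u1_real om ze Cc Dc Rc r (K + i) t) L ^ 2)
  <= Q * psum (fun i => w (K + i)%nat) L.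
Proof.
  intros HT HTg.
  assert (HZ0 : 0 <= Z) by exact (HZ 0 0).
  assert (Hk : 0 <= / (c1 * (g / 2)) ^ 2).
  { left. apply Rinv_0_lt_compat, pow_lt, Rmult_lt_0_compat; lra. }
  assert (HTQ : 0 <= T * (mu ^ 2 * Z)).
  { apply Rmult_le_pos; [lra|]. apply Rmult_le_pos; [apply pow2_ge_0|exact HZ0]. }
  pose proof (upper_cost_ge_0 T g Y HT Hg). pose proof (upper_cost_ge_0 T g d HT Hg).
  (* From [(p + q + s)^2 <= 3 (p^2 + q^2 + s^2)], where the two oscillating parts carry a factor 2
     that squares to 4. *)
  exists (12 * (upper_cost T g Y * 1) + 3 * (T * (mu ^ 2 * Z))
          + 12 * (upper_cost T g d * / (c1 * (g / 2)) ^ 2)).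
  split.
  { assert (0 <= upper_cost T g d * / (c1 * (g / 2)) ^ 2) by now apply Rmult_le_pos. lra. }
  intros K L.
  set (fC := fun t => psum (fun i => cmode (Cc (K + i)%nat) (om (K + i)%nat) t) L).
  set (fD := fun t => psum (fun i => cmode (Dc (K + i)%nat) (ze (K + i)%nat) t) L).
  set (fR := fun t => psum (fun i => Rc (K + i)%nat * exp (r (K + i)%nat * t)) L).
  assert (cC : continuity (fun t => fC t ^ 2)).
  { apply continuity_sq, (continuity_psum (fun i => cmode (Cc (K + i)%nat) (om (K + i)%nat))).
    intros; apply cmode_continuity. }
  assert (cD : continuity (fun t => fD t ^ 2)).
  { apply continuity_sq, (continuity_psum (fun i => cmode (Dc (K + i)%nat) (ze (K + i)%nat))).
    intros; apply cmode_continuity. }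
  assert (cR : continuity (fun t => fR t ^ 2)).
  { apply continuity_sq,
      (continuity_psum (fun i t => Rc (K + i)%nat * exp (r (K + i)%nat * t))).
    intros i; apply derivable_continuity; intros t; auto_derive; auto. }
  assert (cC' := continuity_scal _ 12 cC).
  assert (cD' := continuity_scal _ 12 cD).
  assert (cR' := continuity_scal _ 3 cR).
  assert (cCR := continuity_plus _ _ cC' cR').
  assert (BC := cmode_upper T g Y Cc om 1 w K L HT Hg HTg Gom Yom tail_norm_C).
  assert (BD := cmode_upper T g d Dc ze _ w K L HT Hg HTg Gze Yze tail_norm_D).
  assert (Hw0 : 0 <= psum (fun i => w (K + i)%nat) L)
    by (apply psum_ge_0; intros; apply tail_weight_ge_0).
  assert (BR : wint T (fun t => fR t ^ 2)
               <= T * (mu ^ 2 * Z * psum (fun i => w (K + i)%nat) L)).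
  { apply wint_le_const; auto.
    - apply Rmult_le_pos; [apply Rmult_le_pos; [apply pow2_ge_0|lra]|exact Hw0].
    - intros t Ht.
      apply (real_exponentials_bound (fun i => Rc (K + i)%nat) (fun i => r (K + i)%nat)
               (fun i => rho (K + i)%nat)); auto; try lra.
      intros; apply tail_weight_ge_0. }
  change (wint T (fun t => fC t ^ 2)
          <= upper_cost T g Y * 1 * psum (fun i => w (K + i)%nat) L) in BC.
  change (wint T (fun t => fD t ^ 2)
          <= upper_cost T g d * / (c1 * (g / 2)) ^ 2 * psum (fun i => w (K + i)%nat) L) in BD.
  apply Rle_trans with (wint T (fun t => 12 * fC t ^ 2 + 3 * fR t ^ 2 + 12 * fD t ^ 2)).
  - apply wint_le; auto.
    + apply continuity_sq, (continuity_psum (fun i => u1_real om ze Cc Dc Rc r (K + i))).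
      intros; apply u1_real_continuity.
    + exact (continuity_plus _ _ cCR cD').
    + intros t _. unfold u1_real. rewrite !psum_plus, !psum_scal_cmode.
      fold (fC t) (fD t) (fR t).
      pose proof (pow2_ge_0 (2 * fC t - fR t)). pose proof (pow2_ge_0 (2 * fC t - 2 * fD t)).
      pose proof (pow2_ge_0 (fR t - 2 * fD t)). nra.
  - rewrite (wint_plus T (fun t => 12 * fC t ^ 2 + 3 * fR t ^ 2) (fun t => 12 * fD t ^ 2)) by assumption.
    rewrite (wint_plus T (fun t => 12 * fC t ^ 2) (fun t => 3 * fR t ^ 2)) by assumption.
    rewrite !wint_scal by assumption. lra.
Qed.

Lemma u2_upper T : 0 < T -> 2 * (PI / T) <= g ->
  exists Q, 0 <= Q /\ forall K L,
  wint T (fun t => psum (fun i => u2_real om ze Cc Dc cc dc (K + i) t) L ^ 2)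
  <= Q * psum (fun i => w (K + i)%nat) L.
Proof.
  intros HT HTg.
  pose proof (upper_cost_ge_0 T g Y HT Hg). pose proof (upper_cost_ge_0 T g d HT Hg).
  (* From [(2 E + 2 F)^2 <= 8 E^2 + 8 F^2]. *)
  exists (8 * (upper_cost T g d * 1) + 8 * (upper_cost T g Y * (M / X) ^ 2)).
  split.
  { assert (0 <= upper_cost T g Y * (M / X) ^ 2)
      by (apply Rmult_le_pos; [assumption|apply pow2_ge_0]). lra. }
  intros K L.
  set (fE := fun t => psum (fun i =>
     cmode (Cmul (dc (K + i)%nat) (Dc (K + i)%nat)) (ze (K + i)%nat) t) L).
  set (fF := fun t => psum (fun i =>
     cmode (Cmul (cc (K + i)%nat) (Cc (K + i)%nat)) (om (K + i)%nat) t) L).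
  assert (cE : continuity (fun t => fE t ^ 2)).
  { apply continuity_sq, (continuity_psum (fun i =>
      cmode (Cmul (dc (K + i)%nat) (Dc (K + i)%nat)) (ze (K + i)%nat))).
    intros; apply cmode_continuity. }
  assert (cF : continuity (fun t => fF t ^ 2)).
  { apply continuity_sq, (continuity_psum (fun i =>
      cmode (Cmul (cc (K + i)%nat) (Cc (K + i)%nat)) (om (K + i)%nat))).
    intros; apply cmode_continuity. }
  assert (cE' := continuity_scal _ 8 cE).
  assert (cF' := continuity_scal _ 8 cF).
  assert (BE := cmode_upper T g d (fun i => Cmul (dc i) (Dc i)) ze 1 w K L
                  HT Hg HTg Gze Yze tail_norm_dD).
  assert (BF := cmode_upper T g Y (fun i => Cmul (cc i) (Cc i)) om _ w K L
                  HT Hg HTg Gom Yom tail_norm_cC_w).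
  change (wint T (fun t => fE t ^ 2)
          <= upper_cost T g d * 1 * psum (fun i => w (K + i)%nat) L) in BE.
  change (wint T (fun t => fF t ^ 2)
          <= upper_cost T g Y * (M / X) ^ 2 * psum (fun i => w (K + i)%nat) L) in BF.
  apply Rle_trans with (wint T (fun t => 8 * fE t ^ 2 + 8 * fF t ^ 2)).
  - apply wint_le; auto.
    + apply continuity_sq, (continuity_psum (fun i => u2_real om ze Cc Dc cc dc (K + i))).
      intros; apply u2_real_continuity.
    + exact (continuity_plus _ _ cE' cF').
    + intros t _. unfold u2_real.
      rewrite psum_plus, (psum_scal_cmode (fun i => Cmul (dc (K + i)%nat) (Dc (K + i)%nat))),
        (psum_scal_cmode (fun i => Cmul (cc (K + i)%nat) (Cc (K + i)%nat))).
      fold (fE t) (fF t). pose proof (pow2_ge_0 (fE t - fF t)). nra.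
  - rewrite wint_plus, !wint_scal by assumption. lra.
Qed.

(* Only [u2] is needed: its [C]-part carries the factor [c_n = O(1 / om_n)] and, as [|C_n|] is
   dominated by [|d_n D_n|], is absorbed by the [D]-part as soon as [X] is large. *)
Lemma u2_lower T K : 0 < T -> 2 * (PI / T) <= g ->
  4 * upper_cost T g Y * (M ^ 2 / X) ^ 2 <= (diag_gain T d - offdiag_cost T g d) / 2 ->
  (diag_gain T d - offdiag_cost T g d) / (2 * (1 + M ^ 2)) * psum w K
  <= wint T (fun t => psum (fun i => u2_real om ze Cc Dc cc dc i t) K ^ 2).
Proof.
  intros HT HTg Hsmall.
  set (k := diag_gain T d - offdiag_cost T g d) in *.
  set (E2 := fun i => Cnorm2 (Cmul (dc i) (Dc i))).
  set (fE := fun t => psum (fun i => cmode (Cmul (dc i) (Dc i)) (ze i) t) K).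
  set (fF := fun t => psum (fun i => cmode (Cmul (cc i) (Cc i)) (om i) t) K).
  assert (cE : continuity (fun t => fE t ^ 2)).
  { apply continuity_sq, (continuity_psum (fun i => cmode (Cmul (dc i) (Dc i)) (ze i))).
    intros; apply cmode_continuity. }
  assert (cF : continuity (fun t => fF t ^ 2)).
  { apply continuity_sq, (continuity_psum (fun i => cmode (Cmul (cc i) (Cc i)) (om i))).
    intros; apply cmode_continuity. }
  assert (cE' := continuity_scal _ 2 cE).
  assert (cF' := continuity_scal _ (-4) cF).
  assert (BE : k / 2 * psum E2 K <= wint T (fun t => fE t ^ 2)).
  { pose proof (ingham_lower T g d (fun i => Re (ze i)) (fun i => Im (ze i))
      (fun i => Re (Cmul (dc i) (Dc i))) (fun i => Im (Cmul (dc i) (Dc i)))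
      HT Hg HTg Gze Yze K (diag_gain T d)) as B.
    unfold k. erewrite psum_ext; [apply B|].
    - intros i. now apply diag_gain_mono.
    - intros i _. unfold E2. symmetry. apply amp_Cnorm2. }
  (* Measured against [E2] instead of [w]: one factor [M / X] comes from [c_n], the other [M] from
     [|C_n| <= M |d_n D_n|]. *)
  assert (BF := cmode_upper T g Y (fun i => Cmul (cc i) (Cc i)) om ((M ^ 2 / X) ^ 2) E2 0 K
                  HT Hg HTg Gom Yom).
  assert (HF : wint T (fun t => fF t ^ 2)
               <= upper_cost T g Y * (M ^ 2 / X) ^ 2 * psum E2 K).
  { apply BF. intros i. eapply Rle_trans; [apply tail_norm_cC|].
    replace ((M ^ 2 / X) ^ 2) with ((M / X) ^ 2 * M ^ 2) by (field; lra).
    rewrite Rmult_assoc. apply Rmult_le_compat_l; [apply pow2_ge_0|apply tail_norm_C_dD]. }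
  assert (HE0 : 0 <= psum E2 K) by (apply psum_ge_0; intros; apply Cnorm2_ge_0).
  assert (Hk : 0 <= k).
  { pose proof (upper_cost_ge_0 T g Y HT Hg).
    assert (0 <= 4 * upper_cost T g Y * (M ^ 2 / X) ^ 2)
      by (apply Rmult_le_pos; [lra|apply pow2_ge_0]). lra. }
  assert (HWE : psum w K <= (1 + M ^ 2) * psum E2 K).
  { rewrite <- psum_scal. apply psum_le. intros i _. rewrite Hw.
    pose proof (tail_norm_C_dD i). unfold E2. lra. }
  assert (HM2 : 0 < 1 + M ^ 2) by (pose proof (pow2_ge_0 M); lra).
  apply Rle_trans with (k / 2 * psum E2 K).
  - replace (k / 2 * psum E2 K) with (k / (2 * (1 + M ^ 2)) * ((1 + M ^ 2) * psum E2 K))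
      by (field; lra).
    apply Rmult_le_compat_l; [|exact HWE].
    apply Rmult_le_pos; [exact Hk|left; apply Rinv_0_lt_compat; lra].
  (* [(2 E + 2 F)^2 - 2 E^2 + 4 F^2 = 2 (E + 2 F)^2]. The [E] part yields [k * psum E2 K], of which
     the [F] part costs at most one half. *)
  - apply Rle_trans with (wint T (fun t => 2 * fE t ^ 2 + -4 * fF t ^ 2)).
    + rewrite wint_plus, !wint_scal by assumption.
      assert (4 * upper_cost T g Y * (M ^ 2 / X) ^ 2 * psum E2 K <= k / 2 * psum E2 K)
        by (apply Rmult_le_compat_r; assumption).
      lra.
    + apply wint_le; auto.
      * exact (continuity_plus _ _ cE' cF').
      * apply continuity_sq, (continuity_psum (fun i => u2_real om ze Cc Dc cc dc i)).
        intros; apply u2_real_continuity.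
      * intros t _. unfold u2_real.
        rewrite psum_plus, (psum_scal_cmode (fun i => Cmul (dc i) (Dc i))),
          (psum_scal_cmode (fun i => Cmul (cc i) (Cc i))).
        fold (fE t) (fF t). pose proof (pow2_ge_0 (fE t + 2 * fF t)). nra.
Qed.
End Tail.

(** * Choice of [n0] *)

(** Gaps of at least [g > 0] force linear growth, so [u] eventually exceeds any level [X]. *)
Lemma liminf_gap_tail (u : nat -> R) gamma g X : 0 < g < gamma ->
  liminf_eq (fun n => u (S (S n)) - u (S n)) gamma ->
  exists N, forall n, (n >= N)%nat -> u n + g <= u (S n) /\ X <= u n.
Proof.
  intros Hg H. destruct (H (gamma - g)) as [[N HN] _]; [lra|].
  assert (Hstep : forall k, u (S N + k)%nat + g <= u (S (S N + k))).
  { intros k. specialize (HN (N + k)%nat ltac:(lia)). simpl in *. lra. }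
  assert (Hgrow : forall k, u (S N) + INR k * g <= u (S N + k)%nat).
  { induction k as [|k IH]; [rewrite Nat.add_0_r; simpl; lra|].
    rewrite S_INR, Nat.add_succ_r. specialize (Hstep k). lra. }
  destruct (INR_archimed g (X - u (S N))) as [k Hk]; [lra|].
  exists (S N + k)%nat. intros n Hn.
  replace n with (S N + (n - S N))%nat by lia.
  split; [apply Hstep|].
  assert (Hkn : INR k <= INR (n - S N)) by (apply le_INR; lia).
  specialize (Hgrow (n - S N)%nat). nra.
Qed.

Lemma gapped_tail (u : nat -> R) g n0 : g / 2 <= u n0 ->
  (forall n, (n >= n0)%nat -> u n + g <= u (S n)) -> gapped (fun i => u (n0 + i)%nat) g.
Proof.
  intros H0 H. split; [now rewrite Nat.add_0_r|].
  intros i. rewrite Nat.add_succ_r. apply H. lia.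
Qed.

Lemma infinite_sum_psum f l : infinite_sum f l -> Un_cv (psum f) l.
Proof.
  intros H e He. destruct (H e He) as [N HN].
  (* [sum_f_R0 f n] has [n + 1] terms, hence the shift of the threshold by one. *)
  assert (E : forall n, sum_f_R0 f n = psum f (S n)).
  { induction n as [|n IH]; [simpl; ring|]. simpl in *. now rewrite IH. }
  exists (S N). intros [|n] Hn; [lia|]. rewrite <- E. apply HN. lia.
Qed.

Lemma Un_cv_psum_tail f l k : Un_cv (psum f) l ->
  Un_cv (psum (fun i => f (k + i)%nat)) (l - psum f k).
Proof.
  intros H e He. destruct (H e He) as [N HN].
  exists N. intros n Hn. specialize (HN (k + n)%nat ltac:(lia)).
  rewrite psum_add in HN. unfold R_dist in *.
  replace (psum (fun i => f (k + i)%nat) n - (l - psum f k))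
    with (psum f k + psum (fun i => f (k + i)%nat) n - l) by ring.
  exact HN.
Qed.

(** Squaring gives the exponent [- (1 + a)] with [a = 2 * nu - 1 > 0]; a block is bounded by the
    initial sum that contains it. *)
Lemma Rpower_sq_sum_bound nu m K L : nu > 1 / 2 -> (1 <= m)%nat ->
  psum (fun i => Rpower (INR (S m + (K + i))) (- nu) ^ 2) L
  <= / (2 * nu - 1) * Rpower (INR m) (- (2 * nu - 1)).
Proof.
  intros Hnu Hm.
  set (f := fun i => Rpower (INR (S m + i)) (- nu) ^ 2).
  assert (H : psum f (K + L) <= / (2 * nu - 1) * Rpower (INR m) (- (2 * nu - 1))).
  { rewrite (psum_ext f (fun i => Rpower (INR (S m + i)) (- (1 + (2 * nu - 1))))).
    - apply Rpower_sum_bound; [exact Hm|lra].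
    - intros i _. unfold f. simpl pow. rewrite Rmult_1_r, <- Rpower_plus. f_equal. ring. }
  rewrite psum_add in H.
  assert (0 <= psum f K) by (apply psum_ge_0; intros; apply pow2_ge_0).
  change (psum (fun i => f (K + i)%nat) L
          <= / (2 * nu - 1) * Rpower (INR m) (- (2 * nu - 1))). lra.
Qed.

Lemma Un_cv_scal_le c a b la lb : Un_cv a la -> Un_cv b lb ->
  (forall n, c * a n <= b n) -> c * la <= lb.
Proof.
  intros Ha Hb H.
  apply is_lim_seq_Reals in Ha. apply is_lim_seq_Reals in Hb.
  exact (is_lim_seq_le _ _ _ _ H (is_lim_seq_scal_l a c la Ha) Hb).
Qed.

Lemma vanishing_quotient B m k : 0 <= B -> 0 < k ->
  exists X, 0 < X /\ 4 * B * (m ^ 2 / X) ^ 2 <= k.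
Proof.
  intros HB Hk.
  set (q := 4 * B * (m ^ 2) ^ 2).
  assert (Hq : 0 <= q) by (apply Rmult_le_pos; [lra|apply pow2_ge_0]).
  assert (0 <= q / k) by (apply Rmult_le_pos; [lra|left; now apply Rinv_0_lt_compat]).
  (* This [X] is at least 1, so [k * X ^ 2 >= k * X = k + q >= q]. *)
  exists (1 + q / k). split; [lra|].
  set (X := 1 + q / k) in *.
  replace (4 * B * (m ^ 2 / X) ^ 2) with (q / X ^ 2) by (unfold q, X; field; unfold X in *; lra).
  assert (HX : 0 < X ^ 2) by (apply pow_lt; unfold X; lra).
  apply (Rmult_le_reg_r (X ^ 2)); [exact HX|].
  replace (q / X ^ 2 * X ^ 2) with q by (field; unfold X in *; lra).
  assert (k * X <= k * X ^ 2) by (apply Rmult_le_compat_l; [lra|]; unfold X in *; nra).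
  assert (k * X = k + q) by (unfold X; field; lra). lra.
Qed.

Theorem theorem5p10
  (om ze cc dc : nat -> Cpx) (r : nat -> R)
  (gamma alpha chi mu nu M c1 c2 : R) (n' : nat)
  (Hgamma : gamma > 0) (Halpha : alpha > 0) (Hchi : chi < 0)
  (Hmu : mu > 0) (Hnu : nu > 1/2) (HM : M > 0) (Hc1 : 0 < c1) (Hc12 : c1 <= c2)
  (* (H1) *)
  (H1om : liminf_eq (fun n => Re (om (S (S n))) - Re (om (S n))) gamma)
  (H1ze : liminf_eq (fun n => Re (ze (S (S n))) - Re (ze (S n))) gamma)
  (* (H2) *)
  (H2om : Un_cv (fun n => Im (om n)) alpha)
  (H2r : Un_cv r chi)
  (H2ze : Un_cv (fun n => Im (ze n)) 0)
  (* (H3) *)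
  (H3om : forall n, (n >= 1)%nat -> om n <> C0)
  (H3ze : forall n, (n >= 1)%nat -> ze n <> C0)
  (H3d : forall n, (n >= 1)%nat ->
     c1 * Cabs (ze n) <= Cabs (dc n) /\ Cabs (dc n) <= c2 * Cabs (ze n))
  (H3c : forall n, (n >= 1)%nat -> Cabs (cc n) <= M / Cabs (om n)) :
  forall eps, 0 < eps < 1 ->
  exists n0 : nat, (n0 >= 1)%nat /\
  forall T, T > 2 * PI / (gamma * sqrt (1 - eps)) ->
  exists cT, cT > 0 /\
  forall (Cc Dc : nat -> Cpx) (Rc : nat -> R),
    (* (H4) *)
    (forall n, (n >= n')%nat -> (n >= 1)%nat ->
       Rabs (Rc n) <= mu * Rpower (INR n) (- nu) * sqrt (wgt Cc Dc dc n)) ->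
    (forall n, (n <= n')%nat -> (n >= 1)%nat ->
       Rabs (Rc n) <= mu * sqrt (wgt Cc Dc dc n)) ->
    (* (H5) *)
    (exists Stot, infinite_sum (fun m => wgt Cc Dc dc (S m)) Stot) ->
    (* additional hypothesis |C_n| <= M |d_n D_n| *)
    (forall n, (n >= 1)%nat -> Cabs (Cc n) <= M * Cabs (Cmul (dc n) (Dc n))) ->
    (* conclusion: the integrals of k(|u_1|^2+|u_2|^2) over the partial sums
       converge, and the limit dominates c(T,eps) * sum_{n>=n0} weights *)
    exists I : nat -> R,
      (forall K, RInt_eq (energy T om ze Cc Dc cc dc Rc r n0 K) 0 T (I K)) /\
      exists L, Un_cv I L /\
        forall Ssum, infinite_sum (fun m => wgt Cc Dc dc (n0 + m)%nat) Ssum ->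
          L >= cT * Ssum.
Proof.
  intros eps Heps.
  set (s := sqrt (1 - eps)).
  assert (Hs0 : 0 < s) by (apply sqrt_lt_R0; lra).
  assert (Hs1 : s < 1) by (rewrite <- sqrt_1; apply sqrt_lt_1; lra).
  set (T1 := 2 * PI / (gamma * s)).
  assert (Hgs : 0 < gamma * s) by (apply Rmult_lt_0_compat; lra).
  pose proof PI_RGT_0 as HPI.
  assert (HT1 : 0 < T1) by (apply Rdiv_lt_0_compat; lra).
  (* The midpoint of [gamma * s = 2 * (PI / T1)] and [gamma]: strictly above the former for the
     Ingham gain, strictly below the latter so that all tail gaps reach it. *)
  set (g := gamma * (1 + s) / 2).
  assert (Hgg : gamma * s < g < gamma) by (unfold g; nra).
  assert (Hg : 0 < g) by lra.
  assert (Hpg : 2 * (PI / T1) < g).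
  { replace (2 * (PI / T1)) with (gamma * s) by (unfold T1; field; lra). lra. }
  destruct (gain_exceeds_cost T1 g HT1 Hpg) as (d & Hd & Hgain).
  set (k := diag_gain T1 d - offdiag_cost T1 g d).
  assert (Hk : 0 < k) by (unfold k; lra).
  set (Y := alpha + 1).
  destruct (vanishing_quotient (upper_cost T1 g Y) M (k / 2)) as (X & HX & HXk);
    [now apply upper_cost_ge_0|lra|].
  (* The level [X + g] secures at once [X <= Re om_n] and the starting condition [g / 2 <= x 0] of
     [gapped]. *)
  destruct (liminf_gap_tail (fun n => Re (om n)) gamma g (X + g)) as [N1 HN1];
    [lra|exact H1om|].
  destruct (liminf_gap_tail (fun n => Re (ze n)) gamma g g) as [N2 HN2]; [lra|exact H1ze|].
  destruct (H2om 1) as [N3 HN3]; [lra|].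
  destruct (H2ze d Hd) as [N4 HN4].
  (* Within distance [- chi] of [chi], the exponents [r n] are negative. *)
  destruct (H2r (- chi)) as [N5 HN5]; [lra|].
  (* The summand [n'] places the tail in the decaying case of (H4), and the summand 1 makes [INR m]
     a legitimate base in the bound of the power sum. *)
  set (m := (1 + N1 + N2 + N3 + N4 + N5 + n')%nat).
  set (n0 := S m).
  exists n0. split; [unfold n0; lia|].
  intros T HT.
  assert (HTT1 : T1 < T) by exact HT.
  assert (Hratio : 0 < T1 / T) by (apply Rdiv_lt_0_compat; lra).
  assert (HM2 : 0 < 1 + M ^ 2) by (pose proof (pow2_ge_0 M); lra).
  assert (Hk' : 0 < k / (2 * (1 + M ^ 2))) by (apply Rdiv_lt_0_compat; lra).
  exists (T1 / T * (k / (2 * (1 + M ^ 2)))).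
  split; [now apply Rmult_lt_0_compat|].
  intros Cc Dc Rc H4 _ [Stot H5] HC.
  (* A longer horizon only lowers [PI / T], so the upper bounds hold at [T] with the same tail. *)
  assert (HpT : 2 * (PI / T) <= g).
  { apply Rle_trans with (2 * (PI / T1)); [|lra].
    apply Rmult_le_compat_l; [lra|]. apply Rmult_le_compat_l; [lra|].
    apply Rinv_le_contravar; lra. }
  set (w := fun i => wgt Cc Dc dc (n0 + i)%nat).
  set (rho := fun i => Rpower (INR (n0 + i)) (- nu)).
  set (Z := / (2 * nu - 1) * Rpower (INR m) (- (2 * nu - 1))).
  assert (Gom : gapped (fun i => Re (om (n0 + i)%nat)) g).
  { apply (gapped_tail (fun n => Re (om n))).
    - destruct (HN1 n0); [unfold n0, m; lia|]. lra.
    - intros n Hn. apply HN1. unfold n0, m in Hn. lia. }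
  assert (Gze : gapped (fun i => Re (ze (n0 + i)%nat)) g).
  { apply (gapped_tail (fun n => Re (ze n))).
    - destruct (HN2 n0); [unfold n0, m; lia|]. lra.
    - intros n Hn. apply HN2. unfold n0, m in Hn. lia. }
  assert (Yom : forall i, Rabs (Im (om (n0 + i)%nat)) <= Y).
  { intros i. specialize (HN3 (n0 + i)%nat ltac:(unfold n0, m; lia)).
    unfold R_dist in HN3. apply Rabs_def2 in HN3. apply Rabs_le. unfold Y. lra. }
  assert (Yze : forall i, Rabs (Im (ze (n0 + i)%nat)) <= d).
  { intros i. specialize (HN4 (n0 + i)%nat ltac:(unfold n0, m; lia)).
    unfold R_dist in HN4. rewrite Rminus_0_r in HN4. lra. }
  assert (Xom : forall i, X <= Re (om (n0 + i)%nat)).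
  { intros i. destruct (HN1 (n0 + i)%nat); [unfold n0, m; lia|]. lra. }
  assert (Hr : forall i, r (n0 + i)%nat <= 0).
  { intros i. specialize (HN5 (n0 + i)%nat ltac:(unfold n0, m; lia)).
    unfold R_dist in HN5. apply Rabs_def2 in HN5. lra. }
  assert (Hdc : forall i, c1 * Cabs (ze (n0 + i)%nat) <= Cabs (dc (n0 + i)%nat))
    by (intros i; apply H3d; unfold n0; lia).
  assert (Hcc : forall i, Cabs (cc (n0 + i)%nat) <= M / Cabs (om (n0 + i)%nat))
    by (intros i; apply H3c; unfold n0; lia).
  assert (Hw : forall i, w i = Cnorm2 (Cc (n0 + i)%nat)
                           + Cnorm2 (Cmul (dc (n0 + i)%nat) (Dc (n0 + i)%nat)))
    by reflexivity.
  assert (HZ : forall K L, psum (fun i => rho (K + i)%nat ^ 2) L <= Z)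
    by (intros K L; apply Rpower_sq_sum_bound; [exact Hnu|unfold m; lia]).
  assert (HR : forall i, Rabs (Rc (n0 + i)%nat) <= mu * rho i * sqrt (w i))
    by (intros i; apply H4; unfold n0, m; lia).
  assert (HCn : forall i, Cabs (Cc (n0 + i)%nat)
                     <= M * Cabs (Cmul (dc (n0 + i)%nat) (Dc (n0 + i)%nat)))
    by (intros i; apply HC; unfold n0; lia).
  assert (Hw0 : forall i, 0 <= w i).
  { intros i. apply Rplus_le_le_0_compat; apply Cnorm2_ge_0. }
  assert (HT0 : 0 < T) by lra.
  set (v1 := fun i => u1_real om ze Cc Dc Rc r (n0 + i)).
  set (v2 := fun i => u2_real om ze Cc Dc cc dc (n0 + i)).
  assert (Hv1 : forall i, continuity (v1 i)) by (intros; apply u1_real_continuity).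
  assert (Hv2 : forall i, continuity (v2 i)) by (intros; apply u2_real_continuity).
  set (sh := fun (f : nat -> Cpx) i => f (n0 + i)%nat).
  destruct (u1_upper (sh om) (sh ze) (sh dc) (sh Cc) (sh Dc) (fun i => Rc (n0 + i)%nat)
    (fun i => r (n0 + i)%nat) rho w g Y d c1 mu Z Hg Hc1 Hmu Gom Gze Yom Yze
    Hr Hdc Hw HZ HR T HT0 HpT) as (Q1 & HQ1 & U1).
  destruct (u2_upper (sh om) (sh ze) (sh cc) (sh dc) (sh Cc) (sh Dc)
    w g Y d X M Hg HM HX Gom Gze Yom Yze Xom Hcc Hw T HT0 HpT) as (Q2 & HQ2 & U2).
  (* (H5) sums from index 1, so dropping [m] terms leaves a sum that starts at [S m = n0]. *)
  assert (HW : Un_cv (psum w) (Stot - psum (fun i => wgt Cc Dc dc (S i)) m)).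
  { exact (Un_cv_psum_tail (fun i => wgt Cc Dc dc (S i)) Stot m (infinite_sum_psum _ _ H5)). }
  destruct (wint_square_cv T v1 w _ Q1 HT0 Hv1 Hw0 HW HQ1 U1) as [l1 Hl1].
  destruct (wint_square_cv T v2 w _ Q2 HT0 Hv2 Hw0 HW HQ2 U2) as [l2 Hl2].
  exists (fun K => wint T (fun t => psum (fun i => v1 i t) K ^ 2)
                 + wint T (fun t => psum (fun i => v2 i t) K ^ 2)).
  split; [intros K; now apply energy_RInt|].
  exists (l1 + l2). split; [exact (CV_plus _ _ _ _ Hl1 Hl2)|].
  intros Ssum HS. apply Rle_ge.
  apply (Un_cv_scal_le _ _ _ _ _ (infinite_sum_psum _ _ HS) (CV_plus _ _ _ _ Hl1 Hl2)).
  intros K. fold w.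
  assert (Hc1K : continuity (fun t => psum (fun i => v1 i t) K ^ 2))
    by (now apply continuity_sq, continuity_psum).
  assert (Hc2K : continuity (fun t => psum (fun i => v2 i t) K ^ 2))
    by (now apply continuity_sq, continuity_psum).
  assert (P1 : 0 <= wint T (fun t => psum (fun i => v1 i t) K ^ 2))
    by (apply wint_ge_0; auto; intros; apply pow2_ge_0).
  assert (P2 : T1 / T * wint T1 (fun t => psum (fun i => v2 i t) K ^ 2)
               <= wint T (fun t => psum (fun i => v2 i t) K ^ 2))
    by (apply wint_horizon_mono; auto; [lra|intros; apply pow2_ge_0]).
  assert (P3 : k / (2 * (1 + M ^ 2)) * psum w K
               <= wint T1 (fun t => psum (fun i => v2 i t) K ^ 2)).
  { apply (u2_lower (sh om) (sh ze) (sh cc) (sh dc) (sh Cc) (sh Dc)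
      w g Y d X M Hg HM HX Gom Gze Yom Yze Xom Hcc Hw HCn T1 K HT1); [lra|exact HXk]. }
  apply (Rmult_le_compat_l (T1 / T)) in P3; [|lra].
  rewrite Rmult_assoc. lra.
Qed.
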